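(* Let $\gamma_s$ and $\gamma_{s_1}$ be finitely determined and linearly stable sequence classes such that $\gamma_s$ is $\mathbb{K}$-closed and $\gamma_s$ and $\gamma_{s_1}$ are finitely coincident. Then the sequence $$\left(\left(\mathcal{P}^{m,ev}_{\gamma_{s,s_1}},\pi^{m,ev}(\cdot)\right),\left(\prod\nolimits_{\gamma_{s,s_1}}^{m,ev},\pi^{m,ev}_{\gamma_{s,s_1}}(\cdot)\right)\right)_{m=1}^\infty$$ is coherent and compatible with the operator ideal $\prod_{\gamma_{s,s_1}}$ of $\gamma_{s,s_1}$-summing linear operators.
   Context: All Banach spaces are over a fixed field $\mathbb{K}=\mathbb{R}$ or $\mathbb{C}$; multilinear maps and polynomials are continuous. $\check P$ denotes the symmetric $m$-linear map associated with an $m$-homogeneous polynomial $P$. A sequence class $\gamma_s$ is a rule assigning to each Banach space $E$ a Banach space $\gamma_s(E)$ of $E$-valued sequences (a vector subspace of $E^{\mathbb{N}}$) such that $c_{00}(E)\subseteq\gamma_s(E)\overset{1}{\hookrightarrow}\ell_\infty(E)$ and $\|e_j\|_{\gamma_s(\mathbb{K})}=1$ for every $j$ ($X\overset{1}{\hookrightarrow}Y$: $X$ is a linear subspace of $Y$ and $\|x\|_Y\le\|x\|_X$ for $x\in X$; $c_{00}(E)$: finitely supported sequences; finite sequences are completed with zeros; $e_j$ the $j$-th scalar unit sequence). It is finitely determined if, for every Banach space $E$ and $(x_j)_{j=1}^\infty\in E^{\mathbb{N}}$, $(x_j)_{j=1}^\infty\in\gamma_s(E)$ iff $\sup_k\|(x_j)_{j=1}^k\|_{\gamma_s(E)}<\infty$,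 and then $\|(x_j)_{j=1}^\infty\|_{\gamma_s(E)}$ equals this supremum. It is linearly stable if for every continuous linear $u:E\to F$ between Banach spaces, $(u(x_j))_j\in\gamma_s(F)$ whenever $(x_j)_j\in\gamma_s(E)$, and the induced operator $\hat u:\gamma_s(E)\to\gamma_s(F)$ has $\|\hat u\|=\|u\|$. It is $\mathbb{K}$-closed if for every Banach space $E$, $(x_j)_j\in\gamma_s(\mathbb{K})$ and $(y_j)_j\in\gamma_s(E)$, one has $(x_jy_j)_j\in\gamma_s(E)$ and $\|(x_jy_j)_j\|_{\gamma_s(E)}\le\|(x_j)_j\|_{\gamma_s(\mathbb{K})}\|(y_j)_j\|_{\gamma_s(E)}$. $\gamma_s$ and $\gamma_{s_1}$ are finitely coincident if $\gamma_s(E)=\gamma_{s_1}(E)$ with equal norms for every finite-dimensional space $E$. $\prod_{\gamma_{s,s_1}}^{m,ev}(E_1,\dots,E_m;F)$ is the space of continuous $m$-linear $T:E_1\times\cdots\times E_m\to F$ that are $\gamma_{s,s_1}$-summing at every point: $(T(a_1+x_j^{(1)},\dots,a_m+x_j^{(m)})-T(a_1,\dots,a_m))_{j=1}^\infty\in\gamma_s(F)$ for all $a_i\in E_i$, $(x_j^{(i)})_j\in\gamma_{s_1}(E_i)$. $\pi^{m,ev}_{\gamma_{s,s_1}}(T)$ is the infimum of the $C>0$ such that $$\|(T(a_1+x_j^{(1)},\dots,a_m+x_j^{(m)})-T(a_1,\dots,a_m))_j\|_{\gamma_s(F)}\le C\prod_{i=1}^m(\|a_i\|+\|(x_j^{(i)})_j\|_{\gamma_{s_1}(E_i)})$$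 for all such $a_i$, $(x_j^{(i)})_j$. $\mathcal{P}^{m,ev}_{\gamma_{s,s_1}}(^mE;F)$ is the space of continuous $m$-homogeneous polynomials $P:E\to F$ with $(P(a+x_j)-P(a))_j\in\gamma_s(F)$ for all $a\in E$, $(x_j)_j\in\gamma_{s_1}(E)$; $\pi^{m,ev}(P)$ is the infimum of the $C>0$ such that $\|(P(b+x_j)-P(b))_j\|_{\gamma_s(F)}\le C(\|b\|+\|(x_j)_j\|_{\gamma_{s_1}(E)})^m$ for all $b\in E$, $(x_j)_j\in\gamma_{s_1}(E)$. For $m=1$ both classes equal the operator ideal $\prod_{\gamma_{s,s_1}}$ of $\gamma_{s,s_1}$-summing linear operators. Notation: for $T$ $n$-linear and $a\in E_k$, $T_{a}$ (with $a$ in position $k$, also written $T_{a_k}$) is the $(n-1)$-linear map obtained by fixing the $k$-th variable equal to $a$; $T_{a_1,\dots,a_{k-1},a_{k+1},\dots,a_n}$ is the linear map on $E_k$ obtained by fixing all variables except the $k$-th. For an $n$-homogeneous $P$, $P_a(x)=\check P(a,x,\dots,x)$ and $P_{a^{n-1}}(x)=\check P(a,\dots,a,x)$. For functionals, $(\varphi T)(x_1,\dots,x_{k+1})=\varphi(x_{k+1})T(x_1,\dots,x_k)$, $(\varphi P)(x)=\varphi(x)P(x)$, $(\varphi_1\cdots\varphi_{n-1}u)(x_1,\dots,x_n)=\varphi_1(x_1)\cdots\varphi_{n-1}(x_{n-1})u(x_n)$, $(\varphi^{(n-1)}u)(x)=\varphi(x)^{n-1}u(x)$. Let $\mathcal{U}$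 be a normed operator ideal and $(\mathcal{U}_k,\mathcal{M}_k)_{k=1}^\infty$ a sequence where $\mathcal{U}_k$ is a normed ideal of $k$-homogeneous polynomials, $\mathcal{M}_k$ a normed ideal of $k$-linear maps, and $\mathcal{U}_1=\mathcal{M}_1=\mathcal{U}$. The sequence is coherent if there are positive constants $\beta_1,\beta_2,\beta_3$ such that for all Banach spaces and all $k\ge1$: (CH1) if $T\in\mathcal{M}_{k+1}(E_1,\dots,E_{k+1};F)$ and $a_j\in E_j$, $j=1,\dots,k+1$, then $T_{a_j}\in\mathcal{M}_k(E_1,\dots,E_{j-1},E_{j+1},\dots,E_{k+1};F)$ and $\|T_{a_j}\|_{\mathcal{M}_k}\le\beta_1\|T\|_{\mathcal{M}_{k+1}}\|a_j\|$; (CH2) if $P\in\mathcal{U}_{k+1}(^{k+1}E;F)$ and $a\in E$, then $P_a\in\mathcal{U}_k(^kE;F)$ and $\|P_a\|_{\mathcal{U}_k}\le\beta_2\max\{\|\check P\|_{\mathcal{M}_{k+1}},\|P\|_{\mathcal{U}_{k+1}}\}\|a\|$; (CH3) if $T\in\mathcal{M}_k(E_1,\dots,E_k;F)$ and $\varphi\in E_{k+1}'$, then $\varphi T\in\mathcal{M}_{k+1}(E_1,\dots,E_{k+1};F)$ and $\|\varphi T\|_{\mathcal{M}_{k+1}}\le\beta_3\|\varphi\|\|T\|_{\mathcal{M}_k}$; (CH4) if $P\in\mathcal{U}_k(^kE;F)$ and $\varphi\in E'$, then $\varphi P\in\mathcal{U}_{k+1}(^{k+1}E;F)$; (CH5)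 $P\in\mathcal{U}_k(^kE;F)$ if and only if $\check P\in\mathcal{M}_k(^kE;F)$. The sequence is compatible with $\mathcal{U}$ if there are positive constants $\alpha_1,\alpha_2,\alpha_3$ such that for all Banach spaces and all $n\ge2$: (CP1) if $k\in\{1,\dots,n\}$, $T\in\mathcal{M}_n(E_1,\dots,E_n;F)$ and $a_j\in E_j$ for $j\ne k$, then $T_{a_1,\dots,a_{k-1},a_{k+1},\dots,a_n}\in\mathcal{U}(E_k;F)$ and its $\mathcal{U}$-norm is at most $\alpha_1\|T\|_{\mathcal{M}_n}\prod_{j\ne k}\|a_j\|$; (CP2) if $P\in\mathcal{U}_n(^nE;F)$ and $a\in E$, then $P_{a^{n-1}}\in\mathcal{U}(E;F)$ and $\|P_{a^{n-1}}\|_{\mathcal{U}}\le\alpha_2\max\{\|\check P\|_{\mathcal{M}_n},\|P\|_{\mathcal{U}_n}\}\|a\|^{n-1}$; (CP3) if $u\in\mathcal{U}(E_n;F)$ and $\varphi_j\in E_j'$, $j=1,\dots,n-1$, then $\varphi_1\cdots\varphi_{n-1}u\in\mathcal{M}_n(E_1,\dots,E_n;F)$ and $\|\varphi_1\cdots\varphi_{n-1}u\|_{\mathcal{M}_n}\le\alpha_3\|\varphi_1\|\cdots\|\varphi_{n-1}\|\|u\|_{\mathcal{U}}$; (CP4) if $u\in\mathcal{U}(E;F)$ and $\varphi\in E'$, then $\varphi^{(n-1)}u\in\mathcal{U}_n(^nE;F)$; (CP5) $P\in\mathcal{U}_n(^nE;F)$ if and only if $\check P\in\mathcal{M}_n(^nE;F)$.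 *)

(* Defs.v *)
From HB Require Import structures.
From mathcomp Require Import all_boot all_order all_algebra all_fingroup.
From mathcomp Require Import complex.
From mathcomp Require Import all_classical all_reals.
From mathcomp Require Import topology normedtype.

Set Implicit Arguments.
Unset Strict Implicit.
Unset Printing Implicit Defensive.

Import Order.TTheory GRing.Theory Num.Theory.
Import numFieldNormedType.Exports.

Local Open Scope classical_set_scope.
Local Open Scope ring_scope.

Variant scalar_kind := real_scalars | complex_scalars.

Definition scalar (R : realType) (kind : scalar_kind) : numFieldType :=
  match kind with
  | real_scalars => R
  | complex_scalars => R[i]
  end.

Definition re_scalar (R : realType) (kind : scalar_kind) : scalar R kind -> R :=
  match kind return scalar R kind -> R with
  | real_scalars => id
  | complex_scalars => @complex.Re R
  end.

Lemma complex_complete (R : realType)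
    (F : set_system (R[i] : numFieldType)^o) :
  ProperFilter F -> cauchy F -> cvg F.
Proof.
move=> FF /cauchy_ballP Fc.
have normRe (z : R[i]) : `|complex.Re z| <= complex.Re `|z|.
  by rewrite normc_def/= -sqrtr_sqr ler_wsqrtr// lerDl sqr_ge0.
have normIm (z : R[i]) : `|complex.Im z| <= complex.Re `|z|.
  by rewrite normc_def/= -sqrtr_sqr ler_wsqrtr// lerDr sqr_ge0.
have normle (z : R[i]) :
    complex.Re `|z| <= `|complex.Re z| + `|complex.Im z|.
  rewrite normc_def/= -[leRHS]ger0_norm ?addr_ge0// -sqrtr_sqr ler_wsqrtr//.
  by rewrite sqrrD !real_normK ?num_real// lerD2r lerDl mulrn_wge0// mulr_ge0.
have normlt (z e : R[i]) : (`|z| < e) =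
    (complex.Im e == 0) && (complex.Re `|z| < complex.Re e).
  by rewrite normc_def; case: e => a b; rewrite ltcE/=.
have cauchyP (g : R[i] -> R) : (forall x y, g (x - y) = g x - g y) ->
    (forall z, `|g z| <= complex.Re `|z|) -> cauchy (g @ F).
  move=> gB gle; apply/cauchy_ballP => e e0.
  have e0' : 0 < e%:C%C by rewrite ltcR.
  have [[A B] /= [FA FB] AB] := Fc _ e0'.
  exists (g @` A, g @` B) => /=.
    by split; [apply: filterS FA => x Ax|apply: filterS FB => x Bx]; exists x.
  move=> [_ _] /= [[x Ax <-] [y By <-]].
  have : `|x - y| < e%:C%C by exact: (AB (x, y) (conj Ax By)).
  rewrite normlt => /andP[_] xy.
  by rewrite /ball /= /ball_ /= -gB (le_lt_trans (gle _) xy).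
have reB (x y : R[i]) : complex.Re (x - y) = complex.Re x - complex.Re y.
  by case: x; case: y.
have imB (x y : R[i]) : complex.Im (x - y) = complex.Im x - complex.Im y.
  by case: x; case: y.
have /(@R_complete R _ _)/cvg_ex[/= a Fa] := cauchyP _ reB normRe.
have /(@R_complete R _ _)/cvg_ex[/= b Fb] := cauchyP _ imB normIm.
apply/cvg_ex; exists (a +i* b)%C.
apply/cvgrPdist_lt => /= e.
rewrite ltcE/= => /andP[/eqP im0 re0].
have r0 : 0 < complex.Re e / 2 by rewrite divr_gt0.
move/cvgrPdist_lt : Fa => /(_ _ r0) Fa; move/cvgrPdist_lt : Fb => /(_ _ r0) Fb.
near=> z.
have za : `|a - complex.Re z| < complex.Re e / 2 by near: z; exact: Fa.
have zb : `|b - complex.Im z| < complex.Re e / 2 by near: z; exact: Fb.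
rewrite normlt im0 eqxx/= (le_lt_trans (normle _))// reB imB/=.
by rewrite [ltRHS]splitr ltrD.
Unshelve. all: by end_near. Qed.

Notation banach R kind := (completeNormedModType (scalar R kind)).

Section ScalarBanach.
Context (R : realType) (kind : scalar_kind).

Lemma scalar_complete (F : set_system (scalar R kind)^o) :
  ProperFilter F -> cauchy F -> cvg F.
Proof. by case: kind F; [exact: R_complete | exact: complex_complete]. Qed.

Definition scalar_banach : banach R kind :=
  HB.pack (scalar R kind)^o
    (Uniform_isComplete.Build (scalar R kind)^o scalar_complete).

(* The library norm takes its values in the scalar field; [nrm] is the same
   norm read as an element of [R]. *)
Definition nrm (E : banach R kind) (x : E) : R := re_scalar `|x|.

End ScalarBanach.
Arguments scalar_banach : clear implicits.

Section LinearMaps.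
Context (R : realType) (kind : scalar_kind).
Local Notation K := (scalar R kind).
Local Notation Kb := (scalar_banach R kind).
Local Notation Banach := (banach R kind).

Definition continuous_linear (E F : Banach) (u : E -> F) : Prop :=
  linear u /\ continuous u.

Definition opnorm (E F : Banach) (u : E -> F) : R :=
  sup [set nrm (u x) | x in [set x : E | nrm x <= 1]].

Definition finite_dimensional (E : Banach) : Prop :=
  exists (n : nat) (v : 'I_n -> E),
    forall x : E, exists c : 'I_n -> K, x = \sum_i c i *: v i.

End LinearMaps.

Section SequenceClasses.
Context (R : realType) (kind : scalar_kind).
Local Notation K := (scalar R kind).
Local Notation Kb := (scalar_banach R kind).
Local Notation Banach := (banach R kind).

Definition linf_mem (E : Banach) (x : nat -> E) : Prop :=
  has_ubound (range (fun j => nrm (x j))).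

Definition linf_norm (E : Banach) (x : nat -> E) : R :=
  sup (range (fun j => nrm (x j))).

Definition c00 (E : Banach) : set (nat -> E) :=
  [set x | exists N, forall j, (N <= j)%N -> x j = 0].

Definition unit_seq (j : nat) : nat -> Kb := fun i => (i == j)%:R : K.

(* The subspace of E^N is presented as a Banach space [sc_space E] together
   with the inclusion [sc_seq E], injective and linear, into the space of all
   sequences. *)
Record sequence_class := SequenceClass {
  sc_space : Banach -> Banach;
  sc_seq : forall E : Banach, {linear sc_space E -> (nat -> E)};
  sc_inj : forall E : Banach, injective (sc_seq E);
  sc_c00 : forall E : Banach, @c00 E `<=` range (sc_seq E);
  sc_linf : forall (E : Banach) (s : sc_space E),
    linf_mem (sc_seq E s) /\ linf_norm (sc_seq E s) <= nrm s;
  sc_unit : forall (j : nat) (s : sc_space Kb),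
    sc_seq Kb s = unit_seq j -> nrm s = 1 }.

Definition sc_mem (g : sequence_class) (E : Banach) : set (nat -> E) :=
  range (sc_seq g E).

(* Only meaningful for members of the class; 0 otherwise. *)
Definition sc_norm (g : sequence_class) (E : Banach) (x : nat -> E) : R :=
  nrm (xget 0 [set s : sc_space g E | sc_seq g E s = x]).

Lemma sc_normE (g : sequence_class) (E : Banach) (s : sc_space g E) :
  sc_norm g (sc_seq g E s) = nrm s.
Proof.
by rewrite /sc_norm; case: xgetP => [t _ /sc_inj -> //|/(_ s)/(_ erefl)].
Qed.

Definition truncate (E : Banach) (k : nat) (x : nat -> E) : nat -> E :=
  fun j => if (j < k)%N then x j else 0.

Definition finitely_determined (g : sequence_class) : Prop :=
  forall (E : Banach) (x : nat -> E),
    let truncated_norms := range (fun k => sc_norm g (truncate k x)) in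
    (sc_mem g x <-> has_ubound truncated_norms) /\
    (sc_mem g x -> sc_norm g x = sup truncated_norms).

Definition linearly_stable (g : sequence_class) : Prop :=
  forall (E F : Banach) (u : E -> F), continuous_linear u ->
    exists uhat : sc_space g E -> sc_space g F,
      [/\ forall s, sc_seq g F (uhat s) = u \o sc_seq g E s,
          continuous_linear uhat & opnorm uhat = opnorm u].

Definition K_closed (g : sequence_class) : Prop :=
  forall (E : Banach) (x : nat -> Kb) (y : nat -> E),
    sc_mem g x -> sc_mem g y ->
    let xy := fun j => (x j : K) *: y j in
    sc_mem g xy /\ sc_norm g xy <= sc_norm g x * sc_norm g y.

Definition finitely_coincident (g g1 : sequence_class) : Prop :=
  forall E : Banach, finite_dimensional E -> forall x : nat -> E,
    (sc_mem g x <-> sc_mem g1 x) /\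
    (sc_mem g x -> sc_norm g x = sc_norm g1 x).

End SequenceClasses.

Section Multilinear.
Context (R : realType) (kind : scalar_kind).
Local Notation K := (scalar R kind).
Local Notation Kb := (scalar_banach R kind).
Local Notation Banach := (banach R kind).

Definition multilinear n (E : 'I_n -> Banach) (F : Banach)
    (T : (forall i, E i) -> F) : Prop :=
  forall (a : forall i, E i) (i : 'I_n) (c : K) (x y : E i),
    T (dfwith a i (c *: x + y)) =
    c *: T (dfwith a i x) + T (dfwith a i y).

(* Continuity is with respect to the product topology. *)
Definition continuous_multilinear n (E : 'I_n -> Banach) (F : Banach)
    (T : (forall i, E i) -> F) : Prop :=
  multilinear T /\ continuous (T : prod_topology E -> F).

Definition symmetric_map n (E F : Banach) (T : ('I_n -> E) -> F) : Prop :=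
  forall (s : 'S_n) (x : 'I_n -> E), T (fun i => x (s i)) = T x.

Definition continuous_polynomial n (E F : Banach) (P : E -> F) : Prop :=
  exists2 T : ('I_n -> E) -> F, continuous_multilinear (E := fun=> E) T &
    forall x, P x = T (fun=> x).

Definition polar n (E F : Banach) (P : E -> F) : ('I_n -> E) -> F :=
  xget (fun=> 0) [set T : ('I_n -> E) -> F |
    [/\ continuous_multilinear (E := fun=> E) T, symmetric_map T &
        forall x, P x = T (fun=> x)]].

(* The tuple with [a] in position [j] and the entries of [x], in order, in the
   other positions. *)
Definition insert_var n (E : 'I_n.+1 -> Banach) (j : 'I_n.+1) (a : E j)
    (x : forall i : 'I_n, E (lift j i)) : forall i, E i :=
  fun i => match unliftP j i with
    | UnliftSome i' e => ecast k (E k) (esym e) (x i')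
    | UnliftNone e => ecast k (E k) (esym e) a
    end.

Lemma insert_var_at n (E : 'I_n.+1 -> Banach) (j : 'I_n.+1) (a : E j)
    (x : forall i : 'I_n, E (lift j i)) :
  insert_var a x j = a.
Proof.
rewrite /insert_var; case: unliftP => [i' e|e]; last by rewrite eq_axiomK.
by case/eqP: (neq_lift j i').
Qed.

Lemma insert_var_lift n (E : 'I_n.+1 -> Banach) (j : 'I_n.+1) (a : E j)
    (x : forall i : 'I_n, E (lift j i)) (i : 'I_n) :
  insert_var a x (lift j i) = x i.
Proof.
rewrite /insert_var; case: unliftP => [i' e|e].
  have ii' := lift_inj e; subst i'.
  by rewrite (eq_irrelevance e erefl).
by case/eqP: (neq_lift j i).
Qed.

Definition fix_var n (E : 'I_n.+1 -> Banach) (F : Banach)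
    (T : (forall i, E i) -> F) (j : 'I_n.+1) (a : E j) :
    (forall i : 'I_n, E (lift j i)) -> F :=
  fun x => T (insert_var a x).

(* All variables but the [k]-th are fixed; the entry [a k] plays no role. *)
Definition free_var n (E : 'I_n -> Banach) (F : Banach)
    (T : (forall i, E i) -> F) (a : forall i, E i) (k : 'I_n) : E k -> F :=
  fun x => T (dfwith a k x).

Definition poly_fix1 k (E F : Banach) (P : E -> F) (a : E) : E -> F :=
  fun x => polar P (fun i : 'I_k.+1 => if i == ord0 then a else x).

Definition poly_fix_but1 n (E F : Banach) (P : E -> F) (a : E) : E -> F :=
  fun x => polar P (fun i : 'I_n.+1 => if i == ord_max then x else a).

Definition mul_functional k (E : 'I_k.+1 -> Banach) (F : Banach)
    (phi : E ord_max -> Kb)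
    (T : (forall i : 'I_k, E (lift ord_max i)) -> F) : (forall i, E i) -> F :=
  fun x => (phi (x ord_max) : K) *: T (fun i => x (lift ord_max i)).

Definition mul_functionals n (E : 'I_n.+1 -> Banach) (F : Banach)
    (phi : forall i : 'I_n, E (lift ord_max i) -> Kb) (u : E ord_max -> F) :
    (forall i, E i) -> F :=
  fun x => (\prod_i (phi i (x (lift ord_max i)) : K)) *: u (x ord_max).

Definition poly_mul_functional (n : nat) (E F : Banach) (phi : E -> Kb)
    (P : E -> F) : E -> F :=
  fun x => (phi x : K) ^+ n *: P x.

End Multilinear.

Section Ideals.
Context (R : realType) (kind : scalar_kind).
Local Notation K := (scalar R kind).
Local Notation Kb := (scalar_banach R kind).
Local Notation Banach := (banach R kind).

Record operator_class := OperatorClass {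
  op_mem : forall E F : Banach, set (E -> F);
  op_norm : forall E F : Banach, (E -> F) -> R }.

(* Sequences indexed by the degree; degree 0 is never used. *)
Record polynomial_classes := PolynomialClasses {
  pol_mem : forall (n : nat) (E F : Banach), set (E -> F);
  pol_norm : forall (n : nat) (E F : Banach), (E -> F) -> R }.

Record multilinear_classes := MultilinearClasses {
  mul_mem : forall (n : nat) (E : 'I_n -> Banach) (F : Banach),
    set ((forall i, E i) -> F);
  mul_norm : forall (n : nat) (E : 'I_n -> Banach) (F : Banach),
    ((forall i, E i) -> F) -> R }.

Definition normed_subspace (X : Type) (F : Banach) (A : set (X -> F))
    (N : (X -> F) -> R) : Prop :=
  [/\ A (fun=> 0),
      forall f g, A f -> A g ->
        A (fun x => f x + g x) /\ N (fun x => f x + g x) <= N f + N g,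
      forall (c : K) f, A f ->
        A (fun x => c *: f x) /\
        N (fun x => c *: f x) = nrm (c : Kb) * N f &
      forall f, A f -> 0 <= N f /\ (N f = 0 -> f = fun=> 0)].

Definition normed_operator_ideal (U : operator_class) : Prop :=
  [/\ forall E F : Banach,
        op_mem U (E := E) (F := F) `<=` @continuous_linear R kind E F /\
        normed_subspace (op_mem U (E := E) (F := F))
                        (op_norm U (E := E) (F := F)),
      forall (E F : Banach) (phi : E -> Kb) (y : F),
        continuous_linear phi -> op_mem U (fun x => (phi x : K) *: y),
      forall (E0 E F F0 : Banach) (w : E0 -> E) (u : E -> F) (v : F -> F0),
        continuous_linear w -> op_mem U u -> continuous_linear v ->
        op_mem U (v \o u \o w) /\
        op_norm U (v \o u \o w) <= opnorm v * op_norm U u * opnorm w &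
      op_norm U (id : Kb -> Kb) = 1].

Definition normed_polynomial_ideal (P : polynomial_classes) (n : nat) : Prop :=
  [/\ forall E F : Banach,
        pol_mem P n (E := E) (F := F) `<=`
          @continuous_polynomial R kind n E F /\
        normed_subspace (pol_mem P n (E := E) (F := F))
                        (pol_norm P n (E := E) (F := F)),
      forall (E F : Banach) (phi : E -> Kb) (y : F),
        continuous_linear phi ->
        pol_mem P n (fun x => (phi x : K) ^+ n *: y),
      forall (E0 E F F0 : Banach) (w : E0 -> E) (p : E -> F) (v : F -> F0),
        continuous_linear w -> pol_mem P n p -> continuous_linear v ->
        pol_mem P n (v \o p \o w) /\
        pol_norm P n (v \o p \o w)
          <= opnorm v * pol_norm P n p * opnorm w ^+ n &
      pol_norm P n (fun c : Kb => (c : K) ^+ n : Kb) = 1].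

Definition normed_multilinear_ideal (M : multilinear_classes) (n : nat) :
    Prop :=
  [/\ forall (E : 'I_n -> Banach) (F : Banach),
        mul_mem M (E := E) (F := F) `<=`
          @continuous_multilinear R kind n E F /\
        normed_subspace (mul_mem M (E := E) (F := F))
                        (mul_norm M (E := E) (F := F)),
      forall (E : 'I_n -> Banach) (F : Banach) (phi : forall i, E i -> Kb)
          (y : F),
        (forall i, continuous_linear (phi i)) ->
        mul_mem M (fun x : forall i, E i =>
          (\prod_i (phi i (x i) : K)) *: y),
      forall (E0 E : 'I_n -> Banach) (F F0 : Banach)
          (w : forall i, E0 i -> E i) (T : (forall i, E i) -> F)
          (v : F -> F0),
        (forall i, continuous_linear (w i)) -> mul_mem M T ->
        continuous_linear v ->
        let vTw := fun x : forall i, E0 i => v (T (fun i => w i (x i))) in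
        mul_mem M vTw /\
        mul_norm M vTw <= opnorm v * mul_norm M T * \prod_i opnorm (w i) &
      mul_norm M (fun c : forall _ : 'I_n, Kb =>
        (\prod_i (c i : K)) : Kb) = 1].

(* The identification of the components of degree 1 with [U]; for 1-linear maps
   it reads [x : E ord0] as the 1-tuple with entry [x]. *)
Definition degree1_components (U : operator_class) (P : polynomial_classes)
    (M : multilinear_classes) : Prop :=
  (forall (E F : Banach) (u : E -> F),
     (pol_mem P 1 u <-> op_mem U u) /\
     (op_mem U u -> pol_norm P 1 u = op_norm U u)) /\
  (forall (E : 'I_1 -> Banach) (F : Banach) (T : (forall i, E i) -> F),
     let u := fun x : E ord0 => T (dfwith (fun i => 0 : E i) ord0 x) in
     (mul_mem M T <-> op_mem U u) /\
     (op_mem U u -> mul_norm M T = op_norm U u)).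

Definition ideal_sequence (U : operator_class) (P : polynomial_classes)
    (M : multilinear_classes) : Prop :=
  [/\ normed_operator_ideal U,
      forall k, (0 < k)%N -> normed_polynomial_ideal P k,
      forall k, (0 < k)%N -> normed_multilinear_ideal M k &
      degree1_components U P M].

Section Coherence.
Variables (U : operator_class) (P : polynomial_classes)
  (M : multilinear_classes).

Definition CH1 (beta1 : R) (k : nat) : Prop :=
  forall (E : 'I_k.+1 -> Banach) (F : Banach) (T : (forall i, E i) -> F)
      (j : 'I_k.+1) (a : E j),
    mul_mem M T ->
    mul_mem M (fix_var T a) /\
    mul_norm M (fix_var T a) <= beta1 * mul_norm M T * nrm a.

Definition CH2 (beta2 : R) (k : nat) : Prop :=
  forall (E F : Banach) (p : E -> F) (a : E),
    pol_mem P k.+1 p ->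
    pol_mem P k (poly_fix1 k p a) /\
    pol_norm P k (poly_fix1 k p a) <=
      beta2 * Num.max (mul_norm M (E := fun _ : 'I_k.+1 => E) (polar p))
                      (pol_norm P k.+1 p) * nrm a.

Definition CH3 (beta3 : R) (k : nat) : Prop :=
  forall (E : 'I_k.+1 -> Banach) (F : Banach)
      (T : (forall i : 'I_k, E (lift ord_max i)) -> F)
      (phi : E ord_max -> Kb),
    mul_mem M T -> continuous_linear phi ->
    mul_mem M (mul_functional phi T) /\
    mul_norm M (mul_functional phi T) <= beta3 * opnorm phi * mul_norm M T.

Definition CH4 (k : nat) : Prop :=
  forall (E F : Banach) (p : E -> F) (phi : E -> Kb),
    pol_mem P k p -> continuous_linear phi ->
    pol_mem P k.+1 (poly_mul_functional 1 phi p).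

Definition CH5 (k : nat) : Prop :=
  forall (E F : Banach) (p : E -> F), continuous_polynomial k p ->
    (pol_mem P k p <-> mul_mem M (E := fun _ : 'I_k => E) (polar p)).

Definition coherent : Prop :=
  ideal_sequence U P M /\
  exists beta1 beta2 beta3 : R,
    [/\ 0 < beta1, 0 < beta2, 0 < beta3 &
      forall k, (0 < k)%N ->
        [/\ CH1 beta1 k, CH2 beta2 k, CH3 beta3 k, CH4 k & CH5 k]].

(* In CP1 to CP4 the degree is n + 1. *)
Definition CP1 (alpha1 : R) (n : nat) : Prop :=
  forall (E : 'I_n.+1 -> Banach) (F : Banach) (T : (forall i, E i) -> F)
      (k : 'I_n.+1) (a : forall i, E i),
    mul_mem M T ->
    op_mem U (free_var T a (k := k)) /\
    op_norm U (free_var T a (k := k)) <=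
      alpha1 * mul_norm M T * \prod_(j | j != k) nrm (a j).

Definition CP2 (alpha2 : R) (n : nat) : Prop :=
  forall (E F : Banach) (p : E -> F) (a : E),
    pol_mem P n.+1 p ->
    op_mem U (poly_fix_but1 n p a) /\
    op_norm U (poly_fix_but1 n p a) <=
      alpha2 * Num.max (mul_norm M (E := fun _ : 'I_n.+1 => E) (polar p))
                       (pol_norm P n.+1 p) * nrm a ^+ n.

Definition CP3 (alpha3 : R) (n : nat) : Prop :=
  forall (E : 'I_n.+1 -> Banach) (F : Banach) (u : E ord_max -> F)
      (phi : forall i : 'I_n, E (lift ord_max i) -> Kb),
    op_mem U u -> (forall i, continuous_linear (phi i)) ->
    mul_mem M (mul_functionals phi u) /\
    mul_norm M (mul_functionals phi u) <=
      alpha3 * \prod_i opnorm (phi i) * op_norm U u.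

Definition CP4 (n : nat) : Prop :=
  forall (E F : Banach) (u : E -> F) (phi : E -> Kb),
    op_mem U u -> continuous_linear phi ->
    pol_mem P n.+1 (poly_mul_functional n phi u).

Definition CP5 (n : nat) : Prop := CH5 n.

Definition compatible : Prop :=
  ideal_sequence U P M /\
  exists alpha1 alpha2 alpha3 : R,
    [/\ 0 < alpha1, 0 < alpha2, 0 < alpha3 &
      forall n, (0 < n)%N ->
        [/\ CP1 alpha1 n, CP2 alpha2 n, CP3 alpha3 n, CP4 n & CP5 n.+1]].

End Coherence.
End Ideals.

Section SummingMaps.
Context (R : realType) (kind : scalar_kind).
Variables gs gs1 : sequence_class R kind.
Local Notation Banach := (banach R kind).

Definition summing_mem (E F : Banach) : set (E -> F) :=
  [set u | continuous_linear u /\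
    forall x : nat -> E, sc_mem gs1 x -> sc_mem gs (u \o x)].

Definition summing_norm (E F : Banach) (u : E -> F) : R :=
  inf [set C : R | 0 < C /\
    forall x : nat -> E, sc_mem gs1 x ->
      sc_norm gs (u \o x) <= C * sc_norm gs1 x].

Definition summing_operators : operator_class R kind :=
  OperatorClass summing_mem summing_norm.

Definition multi_increments n (E : 'I_n -> Banach) (F : Banach)
    (T : (forall i, E i) -> F) (a : forall i, E i)
    (x : forall i, nat -> E i) : nat -> F :=
  fun j => T (fun i => a i + x i j) - T a.

Definition ev_multi_mem n (E : 'I_n -> Banach) (F : Banach) :
    set ((forall i, E i) -> F) :=
  [set T | continuous_multilinear T /\
    forall (a : forall i, E i) (x : forall i, nat -> E i),
      (forall i, sc_mem gs1 (x i)) -> sc_mem gs (multi_increments T a x)].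

Definition ev_multi_norm n (E : 'I_n -> Banach) (F : Banach)
    (T : (forall i, E i) -> F) : R :=
  inf [set C : R | 0 < C /\
    forall (a : forall i, E i) (x : forall i, nat -> E i),
      (forall i, sc_mem gs1 (x i)) ->
      sc_norm gs (multi_increments T a x) <=
        C * \prod_i (nrm (a i) + sc_norm gs1 (x i))].

Definition ev_multilinear : multilinear_classes R kind :=
  MultilinearClasses ev_multi_mem ev_multi_norm.

Definition poly_increments (E F : Banach) (P : E -> F) (a : E)
    (x : nat -> E) : nat -> F :=
  fun j => P (a + x j) - P a.

Definition ev_poly_mem n (E F : Banach) : set (E -> F) :=
  [set P | continuous_polynomial n P /\
    forall (a : E) (x : nat -> E),
      sc_mem gs1 x -> sc_mem gs (poly_increments P a x)].

Definition ev_poly_norm n (E F : Banach) (P : E -> F) : R :=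
  inf [set C : R | 0 < C /\
    forall (b : E) (x : nat -> E), sc_mem gs1 x ->
      sc_norm gs (poly_increments P b x) <=
        C * (nrm b + sc_norm gs1 x) ^+ n].

Definition ev_polynomials : polynomial_classes R kind :=
  PolynomialClasses ev_poly_mem ev_poly_norm.

End SummingMaps.

(* Main.v *)
From HB Require Import structures.
From mathcomp Require Import all_boot all_order all_algebra all_fingroup.
From mathcomp Require Import complex.
From mathcomp Require Import all_classical all_reals.
From mathcomp Require Import topology normedtype.
From mathcomp Require Import ring lra.
Require Import Defs.

Set Implicit Arguments.
Unset Strict Implicit.
Unset Printing Implicit Defensive.

Import Order.TTheory GRing.Theory Num.Theory.
Import numFieldNormedType.Exports.

Local Open Scope classical_set_scope.
Local Open Scope ring_scope.

(** Once the three norms are known to be finite, all conditions follow from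
    estimates on increments, [T (a + x_j) - T a].

    Finiteness ([ev_multi_bounded]) comes from uniform boundedness. The sequence
    of increments of a summing [T] depends multilinearly on the pairs
    [(a i, x i)], where [x i] runs over the Banach space that the second class
    attaches to [E i]. As the first class is finitely determined, the norm of
    this sequence is the supremum of the norms of its truncations, which are
    continuous because [T] is; a multilinear map with lower semicontinuous norm
    is bounded, by a Baire argument ([multilinear_lsc_bounded]). For polynomials
    and linear operators the finiteness is inherited from multilinear maps:
    [ev_multi_polar] shows, by polarization, that the symmetric multilinear map
    of a summing polynomial is summing, which is also (CH5).

    Fixing a variable costs nothing, because paired with the zero sequence it
    contributes to the product of weights only the norm of the fixed element;
    together with restriction to the diagonal this gives (CH1), (CH2), (CP1) and
    (CP2).

    For products with functionals, a functional sends the second class over [E]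
    to the second class over the scalars, where the two classes coincide, and
      [(c + xi_j) (v + w_j) - c v = c w_j + xi_j v + xi_j w_j]
    is in the first class by linear stability and closedness under products with
    scalar sequences. If [c], [xi], [v], [w] have sizes at most [A], [X], [Q],
    [D], then this has size at most [(A + X) (Q + D) - A Q]
    ([sc_in_product]). The subtracted term makes the bound telescope when several
    functionals are multiplied, so that the constant in (CP3) does not depend on
    the degree ([sc_in_functionals]). *)

(** * The real-valued norm *)

Section RealNorm.
Context (R : realType) (kind : scalar_kind).
Local Notation K := (scalar R kind).
Local Notation Kb := (scalar_banach R kind).
Local Notation Banach := (banach R kind).

Definition of_real : R -> K :=
  match kind return R -> scalar R kind with
  | real_scalars => id
  | complex_scalars => fun r => r%:C%C
  end.

Lemma re_of_real r : re_scalar (of_real r) = r.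
Proof. by rewrite /of_real /re_scalar; case: kind. Qed.

Lemma of_realK (x : K) : 0 <= x -> of_real (re_scalar x) = x.
Proof.
rewrite /of_real /re_scalar /scalar in x *; case: kind x => // -[a b].
by rewrite lecE/= => /andP[/eqP ->].
Qed.

Lemma ler_of_real a b : (of_real a <= of_real b) = (a <= b).
Proof. by rewrite /of_real; case: kind => //; rewrite lecR. Qed.

Lemma of_real0 : of_real 0 = 0.
Proof. by rewrite /of_real; case: kind. Qed.

Lemma of_real1 : of_real 1 = 1.
Proof. by rewrite /of_real; case: kind. Qed.

Lemma of_realD a b : of_real (a + b) = of_real a + of_real b.
Proof. by rewrite /of_real; case: kind => //; rewrite rmorphD. Qed.

Lemma of_realM a b : of_real (a * b) = of_real a * of_real b.
Proof. by rewrite /of_real; case: kind => //; rewrite rmorphM. Qed.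

Lemma ltr_of_real a b : (of_real a < of_real b) = (a < b).
Proof. by rewrite /of_real; case: kind => //; rewrite ltcR. Qed.

Lemma nrmE (E : Banach) (x : E) : `|x| = of_real (nrm x).
Proof. by rewrite /nrm of_realK. Qed.

Lemma nrm_ge0 (E : Banach) (x : E) : 0 <= nrm x.
Proof. by rewrite -ler_of_real -nrmE of_real0. Qed.

Lemma nrm0 (E : Banach) : nrm (0 : E) = 0.
Proof. by rewrite /nrm normr0 -of_real0 re_of_real. Qed.

Lemma nrm_eq0 (E : Banach) (x : E) : nrm x = 0 -> x = 0.
Proof. by move=> x0; apply/normr0_eq0; rewrite nrmE x0 of_real0. Qed.

Lemma ler_nrmD (E : Banach) (x y : E) : nrm (x + y) <= nrm x + nrm y.
Proof. by rewrite -ler_of_real of_realD -!nrmE ler_normD. Qed.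

Lemma nrmN (E : Banach) (x : E) : nrm (- x) = nrm x.
Proof. by rewrite /nrm normrN. Qed.

Lemma ler_nrmB (E : Banach) (x y : E) : nrm (x - y) <= nrm x + nrm y.
Proof. by rewrite -(nrmN y) ler_nrmD. Qed.

Lemma nrmBC (E : Banach) (x y : E) : nrm (x - y) = nrm (y - x).
Proof. by rewrite -nrmN opprB. Qed.

Lemma nrmZ (E : Banach) (c : K) (x : E) : nrm (c *: x) = nrm (c : Kb) * nrm x.
Proof. by rewrite {1}/nrm normrZ (nrmE x) (nrmE (c : Kb)) -of_realM re_of_real. Qed.

Lemma nrmM (c d : K) : nrm (c * d : Kb) = nrm (c : Kb) * nrm (d : Kb).
Proof. exact: (nrmZ c (d : Kb)). Qed.

Lemma nrm1 : nrm (1 : Kb) = 1.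
Proof. by rewrite /nrm normr1 -of_real1 re_of_real. Qed.

Lemma nrm_of_real r : 0 <= r -> nrm (of_real r : Kb) = r.
Proof.
by move=> r0; rewrite /nrm ger0_norm ?re_of_real// -of_real0 ler_of_real.
Qed.

Lemma nrm_prod (I : Type) (s : seq I) (c : I -> K) :
  nrm (\prod_(i <- s) c i : Kb) = \prod_(i <- s) nrm (c i : Kb).
Proof. by elim/big_rec2: _ => [|i y x _ <-]; [exact: nrm1|exact: nrmM]. Qed.

(** Balls of real radius generate the neighbourhoods, because a positive
    scalar is a real one. *)
Lemma nbhs_nrmP (E : Banach) (x : E) (A : set E) :
  nbhs x A <-> exists2 r : R, 0 < r & forall y, nrm (x - y) < r -> A y.
Proof.
split=> [/nbhs_ballP[e e0 eA]|[r r0 rA]].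
  have er : of_real (re_scalar e) = e by rewrite of_realK// ltW.
  exists (re_scalar e); first by rewrite -ltr_of_real er of_real0.
  move=> y xy; apply: eA; rewrite -ball_normE /ball_ /=.
  by rewrite nrmE -er ltr_of_real.
apply/nbhs_ballP; exists (of_real r) => /=; first by rewrite -of_real0 ltr_of_real.
by move=> y; rewrite -ball_normE /ball_ /= nrmE ltr_of_real => /rA.
Qed.

Lemma cvg_nrmP (T : Type) (D : set_system T) (E : Banach) (f : T -> E) (x : E) :
  Filter D ->
  f @ D --> x <->
  forall e : R, 0 < e -> D [set t | nrm (x - f t) < e].
Proof.
move=> FD; split=> [fx e e0|fx A /nbhs_nrmP[r r0 rA]].
  by apply: (fx [set y | nrm (x - y) < e]); apply/nbhs_nrmP; exists e.
by apply: filterS (fx _ r0) => t; exact: rA.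
Qed.

Lemma continuous_nrmP (E F : Banach) (f : E -> F) :
  continuous f <->
  forall x (e : R), 0 < e ->
    exists2 r : R, 0 < r & forall y, nrm (x - y) < r -> nrm (f x - f y) < e.
Proof.
split=> [cf x e e0|cf x].
  by apply/nbhs_nrmP; move/(cvg_nrmP _ (f x)) : (cf x); apply.
by apply/cvg_nrmP => e e0; apply/nbhs_nrmP; exact: cf.
Qed.

Lemma cauchy_nrm_cvg (E : Banach) (f : nat -> E) :
  (forall e : R, 0 < e ->
     exists N, forall p q, (N <= p)%N -> (N <= q)%N -> nrm (f p - f q) < e) ->
  exists l : E, forall e : R, 0 < e ->
     exists N, forall p, (N <= p)%N -> nrm (l - f p) < e.
Proof.
move=> fc.
have /cauchy_cvgP/cvg_ex[/= l fl] : cauchy (f @ \oo).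
  apply/cauchy_ballP => e e0.
  have er : of_real (re_scalar e) = e by rewrite of_realK// ltW.
  have [|N fN] := fc (re_scalar e); first by rewrite -ltr_of_real er of_real0.
  exists (f @` [set p | (N <= p)%N], f @` [set p | (N <= p)%N]) => /=.
    by split; exists N => //= p Np; exists p.
  move=> [_ _] /= [[p Np <-] [q Nq <-]].
  by rewrite -ball_normE /ball_ /= nrmE -er ltr_of_real fN.
exists l => e e0; move/cvg_nrmP : fl => /(_ _ e0)[N _ fN].
by exists N => p Np; exact: fN.
Qed.

End RealNorm.

(** * Products of two Banach spaces *)

HB.saturate prod.

Section ProductBanach.
Context (R : realType) (kind : scalar_kind).
Local Notation Banach := (banach R kind).


Lemma prod_cauchy_cvg (E F : Banach) (D : set_system (E * F)%type) :
  ProperFilter D -> cauchy D -> cvg D.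
Proof.
move=> PD /cauchy_ballP Dc.
have c1 : cauchy (fst @ D).
  apply/cauchy_ballP => e e0; have [[A B] /= [DA DB] AB] := Dc _ e0.
  exists (fst @` A, fst @` B) => /=.
    by split; [apply: filterS DA => x Ax|apply: filterS DB => x Bx]; exists x.
  by move=> [_ _] /= [[x Ax <-] [y By <-]]; have [] := AB (x, y) (conj Ax By).
have c2 : cauchy (snd @ D).
  apply/cauchy_ballP => e e0; have [[A B] /= [DA DB] AB] := Dc _ e0.
  exists (snd @` A, snd @` B) => /=.
    by split; [apply: filterS DA => x Ax|apply: filterS DB => x Bx]; exists x.
  by move=> [_ _] /= [[x Ax <-] [y By <-]]; have [] := AB (x, y) (conj Ax By).
move/cauchy_cvgP/cvg_ex : c1 => [a Da]; move/cauchy_cvgP/cvg_ex : c2 => [b Db].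
apply/cvg_ex; exists (a, b).
move=> A [[B C] /= [aB bC] BC].
have DB : D (fst @^-1` B) by exact: Da.
have DC : D (snd @^-1` C) by exact: Db.
change (D A).
by apply: filterS (filterI DB DC) => -[x y] [Bx Cy]; exact: (BC (x, y)).
Qed.

Definition prod_banach (E F : Banach) : Banach :=
  HB.pack (E * F)%type (Uniform_isComplete.Build (E * F)%type (@prod_cauchy_cvg E F)).

Lemma nrm_prod_banach (E F : Banach) (z : prod_banach E F) :
  nrm z = Num.max (nrm z.1) (nrm z.2).
Proof.
have -> : nrm z = re_scalar (Num.max `|z.1| `|z.2|) by [].
rewrite !nrmE; case: (leP (nrm z.1) (nrm z.2)) => h.
  by rewrite max_r ?ler_of_real// re_of_real.
by rewrite max_l ?re_of_real// ler_of_real ltW.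
Qed.

End ProductBanach.

(** * Continuity for the product topology *)

Section ProductTopology.

Lemma prod_topology_cvg (I : Type) (X : I -> topologicalType)
    (D : set_system (forall i, X i)) (t : forall i, X i) :
  Filter D -> (forall i, (fun g : forall i, X i => g i) @ D --> t i) ->
  D --> (t : prod_topology X).
Proof.
move=> FD Dt; apply/cvg_sup => i A [B [[C oC <-] Ct CA]].
by apply: filterS CA _; apply: (Dt i); exact: open_nbhs_nbhs.
Qed.

Lemma continuous_into_prod (S : topologicalType) (I : Type)
    (X : I -> topologicalType) (f : S -> prod_topology X) :
  (forall i, continuous (fun x => f x i)) -> continuous f.
Proof. by move=> fc x; apply: prod_topology_cvg => i; exact: fc. Qed.

Lemma continuous_coordinate (I : eqType) (X : I -> topologicalType) (i : I) :
  continuous (fun g : prod_topology X => g i).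
Proof. exact: (@proj_continuous I X i). Qed.

End ProductTopology.

(** * Multilinear maps *)

(** Growing [s] to an enumeration of the indices changes [w] into [z] one
    coordinate at a time; this is how one-variable properties of multilinear
    maps are propagated to all variables. *)
Definition mix (I : eqType) (Z : I -> Type) (z w : forall i, Z i) (s : seq I) :
    forall i, Z i :=
  fun i => if i \in s then z i else w i.

Section Mix.
Context (I : eqType) (Z : I -> Type).
Implicit Types (z w : forall i, Z i) (s : seq I).

Lemma mix_nil z w : mix z w [::] = w.
Proof. by []. Qed.

Lemma mix_cons z w k s : mix z w (k :: s) = dfwith (mix z w s) k (z k).
Proof.
apply: functional_extensionality_dep => i; rewrite /mix.
by case: dfwithP => [|j kj]; rewrite inE ?eqxx// eq_sym (negbTE kj).
Qed.

Lemma dfwith_id z k : dfwith z k (z k) = z.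
Proof. by apply: functional_extensionality_dep => i; case: dfwithP. Qed.

Lemma mix_out z w k s : k \notin s -> dfwith (mix z w s) k (w k) = mix z w s.
Proof.
move=> ks; rewrite -[RHS](dfwith_id _ k); congr dfwith.
by rewrite /mix (negbTE ks).
Qed.

Lemma mix_dfwith z w k (x : Z k) s : k \notin s ->
  dfwith (mix z w s) k x = mix z (dfwith w k x) s.
Proof.
move=> ks; apply: functional_extensionality_dep => i; rewrite /mix.
case: dfwithP => [|j kj]; first by rewrite (negbTE ks) dfwithin.
by rewrite dfwithout.
Qed.

End Mix.

Lemma mix_enum (I : finType) (Z : I -> Type) (z w : forall i, Z i) :
  mix z w (enum I) = z.
Proof. by apply: functional_extensionality_dep => i; rewrite /mix mem_enum. Qed.

Section Multilinear.
Context (R : realType) (kind : scalar_kind).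
Local Notation K := (scalar R kind).
Local Notation Kb := (scalar_banach R kind).
Local Notation Banach := (banach R kind).

Section Algebra.
Context (n : nat) (E : 'I_n -> Banach) (F : Banach) (T : (forall i, E i) -> F).
Hypothesis Tlin : multilinear T.

Lemma multilinearD a i (x y : E i) :
  T (dfwith a i (x + y)) = T (dfwith a i x) + T (dfwith a i y).
Proof. by have := Tlin a 1 x y; rewrite !scale1r. Qed.

Lemma multilinear_eq0 a i : a i = 0 -> T a = 0.
Proof.
move=> ai; have := multilinearD a (0 : E i) 0; rewrite addr0 -ai dfwith_id.
by move/eqP; rewrite -subr_eq subrr eq_sym => /eqP.
Qed.

Lemma multilinearZ a i (c : K) (x : E i) :
  T (dfwith a i (c *: x)) = c *: T (dfwith a i x).
Proof.
have := Tlin a c x 0; rewrite addr0 => ->.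
by rewrite (@multilinear_eq0 (dfwith a i 0) i) ?addr0// dfwithin.
Qed.

Lemma multilinear_sum (J : Type) (s : seq J) a i (x : J -> E i) :
  T (dfwith a i (\sum_(j <- s) x j)) = \sum_(j <- s) T (dfwith a i (x j)).
Proof.
elim: s => [|j s IH]; last by rewrite !big_cons multilinearD IH.
by rewrite !big_nil (@multilinear_eq0 _ i)// dfwithin.
Qed.

Lemma multilinear_scale (c : 'I_n -> K) (x : forall i, E i) :
  T (fun i => c i *: x i) = (\prod_i c i) *: T x.
Proof.
suff H s : uniq s -> T (mix (fun i => c i *: x i) x s) = (\prod_(i <- s) c i) *: T x.
  have := H (enum 'I_n) (enum_uniq _); rewrite mix_enum => ->.
  by rewrite big_enum.
elim: s => [|k s IH] /=; first by rewrite big_nil scale1r.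
case/andP=> ks us; rewrite mix_cons multilinearZ mix_out// IH// scalerA.
by rewrite big_cons.
Qed.

(** The variables are expanded one after the other; the support condition of
    [pfamily] makes the choice functions on the expanded variables unique. *)
Lemma multilinear_expand (J : finType) (y : forall i, J -> E i) :
  (0 < #|J|)%N ->
  T (fun i => \sum_j y i j) = \sum_(f : {ffun 'I_n -> J}) T (fun i => y i (f i)).
Proof.
move=> /card_gt0P[j0 _].
pose fIJ := {ffun 'I_n -> J}.
pose Y i := \sum_j y i j.
pose Pf s := pfamily j0 (mem (s : seq 'I_n)) (fun=> predT : pred J).
suff H s z : uniq s ->
    T (mix Y z s) = \sum_(f : fIJ | f \in Pf s) T (mix (fun i => y i (f i)) z s).
  have := H (enum 'I_n) Y (enum_uniq _); rewrite mix_enum => ->.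
  apply: eq_big => [f|f _]; last by rewrite mix_enum.
  by apply/familyP => i; rewrite /= mem_enum.
elim: s z => /= [z _ | k s IH z /andP[ks us]].
  rewrite (big_pred1 [ffun=> j0]) ?mix_nil// => f.
  apply/familyP/eqP=> /= [Df |->{f} i]; last by rewrite ffunE !inE.
  by apply/ffunP=> i; rewrite ffunE; apply/eqP/Df.
rewrite mix_cons multilinear_sum.
rewrite (partition_big (fun f : fIJ => f k) predT)//=.
apply: eq_bigr => j _; rewrite mix_dfwith// IH//.
pose seti j (f : fIJ) := [ffun i => if i == k then j else f i].
rewrite [RHS](reindex_onto (seti j) (seti j0)) => [|f /andP[_ /eqP fi]]; last first.
  by apply/ffunP=> i; rewrite !ffunE; case: eqP => // ->.
apply: eq_big => [f | f _]; last first.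
  congr T; rewrite mix_cons /= [seti j f k]ffunE eqxx -mix_dfwith//; apply: (congr1 (fun g => dfwith g k (y k j))).
  apply: functional_extensionality_dep => i; rewrite /mix ffunE.
  by case: ifP => // si; case: eqP si ks => // -> ->.
rewrite !ffunE !eqxx andbT; apply/familyP/andP=> /= [Pff | [Pjf fij0] i].
  (split; [apply/familyP | apply/eqP/ffunP]) => i; have /[!(ffunE, inE)]:= Pff i.
    by case: eqP => // ->.
  by case: eqP => // ->; rewrite (negbTE ks) /= => /eqP.
have /[!(ffunE, inE)] := familyP Pjf i; case: eqP => // -> _.
by rewrite (negbTE ks) -(eqP fij0) !ffunE !inE !eqxx.
Qed.

End Algebra.

Lemma multilinear_perm n (E F : Banach) (T : ('I_n -> E) -> F) (s : 'S_n) :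
  multilinear (E := fun=> E) T ->
  multilinear (E := fun=> E) (fun x => T (fun i => x (s i))).
Proof.
move=> Tl a i c x y.
have dE (z : E) : (fun j => dfwith (T := fun=> E) a i z (s j)) =
    dfwith (T := fun=> E) (fun j => a (s j)) ((s^-1)%g i) z.
  apply/funext => j; have [<-|ij] := eqVneq ((s^-1)%g i) j.
    by rewrite permKV !dfwithin.
  by rewrite !dfwithout//; apply: contraNneq ij => ->; rewrite permK.
by rewrite !dE (Tl _ _ c).
Qed.

(** * Polarization *)

(** If [f] misses an index [k], flipping the sign [b k] negates every term; if
    [f] is a permutation, every term is 1. *)
Lemma sum_signs (L : numDomainType) (n : nat) (f : {ffun 'I_n -> 'I_n}) :
  \sum_(b : {ffun 'I_n -> bool})
     (\prod_i (-1) ^+ b i) * (\prod_i (-1) ^+ b (f i)) =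
  (if injectiveb f then 2 ^+ n else 0) :> L.
Proof.
case: ifPn => [/injectiveP finj|fninj].
  rewrite (eq_bigr (fun=> 1)) => [|b _].
    by rewrite sumr_const card_ffun card_bool card_ord natrX.
  rewrite -(reindex_inj (P := predT) (F := fun i => (-1) ^+ b i) finj)/=.
  by rewrite -big_split big1//= => i _; rewrite -expr2 sqrr_sign.
have [k kf] : exists k, k \notin codom f.
  apply/existsP; move: fninj; apply: contraNT; rewrite negb_exists => /forallP kf.
  apply/card_uniqP; rewrite size_map -cardE.
  by apply: eq_card => k; have := kf k; rewrite negbK.
set S := LHS; suff SN : S = - S.
  by have /eqP : S *+ 2 = 0 by [rewrite mulr2n {1}SN addNr]; rewrite mulrn_eq0 => /eqP.
pose flip (b : {ffun 'I_n -> bool}) := [ffun i => b i (+) (i == k)].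
have flipK : involutive flip.
  by move=> b; apply/ffunP => i; rewrite !ffunE -addbA addbb addbF.
rewrite {1}/S (reindex_inj (inv_inj flipK)) /S -sumrN; apply: eq_bigr => b _.
have -> : \prod_i (-1) ^+ flip b i = - \prod_i (-1) ^+ b i :> L.
  rewrite (eq_bigr (fun i => (-1) ^+ b i * (-1) ^+ (i == k))) => [|i _].
    rewrite big_split/= -[RHS]mulrN1; congr (_ * _).
    by rewrite (bigD1 k)//= eqxx big1 ?mulr1// => i /negbTE ->.
  by rewrite ffunE signr_addb.
have -> : \prod_i (-1) ^+ flip b (f i) = \prod_i (-1) ^+ b (f i) :> L.
  apply: eq_bigr => i _; rewrite ffunE; case: eqP => [fk|_]; last by rewrite addbF.
  by move: kf; rewrite -fk codom_f.
by rewrite mulNr.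
Qed.

(** Expanding the left-hand side gives a sum over all maps [f] of indices, and
    the signs cancel unless [f] is a permutation. *)
Lemma polarization n (E F : Banach) (T : ('I_n -> E) -> F) (x : 'I_n -> E) :
  multilinear (E := fun=> E) T -> symmetric_map T ->
  \sum_(b : {ffun 'I_n -> bool})
     (\prod_i (-1) ^+ b i : K) *: T (fun=> \sum_i ((-1) ^+ b i : K) *: x i) =
  (2 ^+ n * n`!%:R : K) *: T x.
Proof.
move=> Tl Ts; case: n T x Tl Ts => [|n] T x Tl Ts.
  have -> : x = fun=> 0 by apply/funext => -[].
  rewrite (big_pred1 [ffun=> true]) => [|b]; last first.
    by rewrite /=; apply/esym/eqP/ffunP => -[].
  rewrite big_ord0 expr0 fact0 mulr1 !scale1r; congr T.
  by apply/funext => -[].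
have expand (b : {ffun 'I_n.+1 -> bool}) :
    T (fun=> \sum_i ((-1) ^+ b i : K) *: x i) =
    \sum_(f : {ffun 'I_n.+1 -> 'I_n.+1})
       (\prod_i (-1) ^+ b (f i) : K) *: T (fun i => x (f i)).
  rewrite (multilinear_expand Tl (fun _ j => ((-1) ^+ b j : K) *: x j)) ?card_ord//.
  by apply: eq_bigr => f _; rewrite (multilinear_scale Tl (fun i => (-1) ^+ b (f i))).
rewrite (eq_bigr _ (fun b _ => congr1 _ (expand b))).
rewrite (eq_bigr _ (fun b _ => scaler_sumr _ _ _ _)).
rewrite exchange_big/=.
under eq_bigr => f _.
  under eq_bigr do rewrite scalerA.
  rewrite -scaler_suml sum_signs; over.
rewrite (bigID (fun f : {ffun 'I_n.+1 -> 'I_n.+1} => injectiveb f))/=.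
rewrite [X in _ + X]big1 ?addr0 => [|f /negbTE ->]; last by rewrite scale0r.
rewrite (reindex (@pval _)) /=; last first.
  pose in_Sn := insubd (1%g : 'S_n.+1).
  by exists in_Sn => /= f Uf; first apply: val_inj; apply: insubdK.
rewrite (eq_big predT (fun=> (2 ^+ n.+1 : K) *: T x)) => [|s|s _]; last 2 first.
- by rewrite (valP s).
- rewrite (valP s); congr (_ *: _); rewrite -[RHS](Ts s); congr T.
  by apply/funext => i; rewrite pvalE.
by rewrite sumr_const card_Sn mulr_natr scalerMnl.
Qed.

End Multilinear.

(** * Continuous linear and multilinear maps *)

Section OperatorNorm.
Context (R : realType) (kind : scalar_kind).
Local Notation K := (scalar R kind).
Local Notation Kb := (scalar_banach R kind).
Local Notation Banach := (banach R kind).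

Section OneMap.
Context (E F : Banach) (u : E -> F).
Hypothesis uP : continuous_linear u.

Lemma cl_D x y : u (x + y) = u x + u y.
Proof. by have := uP.1 1 x y; rewrite !scale1r. Qed.

Lemma cl_0 : u 0 = 0.
Proof. by have /eqP := cl_D 0 0; rewrite addr0 -subr_eq subrr eq_sym => /eqP. Qed.

Lemma cl_Z (c : K) x : u (c *: x) = c *: u x.
Proof. by have := uP.1 c x 0; rewrite addr0 cl_0 addr0. Qed.

Lemma cl_B x y : u (x - y) = u x - u y.
Proof. by rewrite cl_D -scaleN1r cl_Z scaleN1r. Qed.

Lemma opnorm_bounded :
  has_ubound [set nrm (u x) | x in [set x : E | nrm x <= 1]].
Proof.
have [r r0 ur] := (continuous_nrmP u).1 uP.2 0 1 ltr01.
exists (2 / r) => _ [x /= x1 <-].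
have h : nrm (0 - (of_real kind (r / 2) *: x)) < r.
  rewrite sub0r nrmN nrmZ nrm_of_real ?divr_ge0 ?ltW//.
  by rewrite (@le_lt_trans _ _ (r / 2)) ?ler_piMr ?divr_ge0 ?(ltW r0)// gtr_pMr// invf_lt1// ltr1n.
have := ur _ h; rewrite cl_0 sub0r nrmN cl_Z nrmZ nrm_of_real ?divr_ge0 ?(ltW r0)//.
by rewrite -ltr_pdivlMl ?divr_gt0// mulr1 invf_div => /ltW.
Qed.

Lemma nrm_le_opnorm x : nrm (u x) <= opnorm u * nrm x.
Proof.
have [x0|x0] := eqVneq (nrm x) 0.
  by rewrite (nrm_eq0 x0) cl_0 !nrm0 mulr0.
have xgt0 : 0 < nrm x by rewrite lt_def x0 nrm_ge0.
rewrite -ler_pdivrMr//; apply: ub_le_sup; first exact: opnorm_bounded.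
exists (of_real kind (nrm x)^-1 *: x) => /=.
  by rewrite nrmZ nrm_of_real ?invr_ge0 ?nrm_ge0// mulVf.
by rewrite cl_Z nrmZ nrm_of_real ?invr_ge0 ?nrm_ge0// mulrC.
Qed.

Lemma opnorm_ge0 : 0 <= opnorm u.
Proof.
by apply: ub_le_sup; [exact: opnorm_bounded | exists 0; rewrite /= ?cl_0 nrm0].
Qed.

Lemma opnorm_le C : 0 <= C -> (forall x, nrm (u x) <= C * nrm x) -> opnorm u <= C.
Proof.
move=> C0 uC; apply: ge_sup; first by exists (nrm (u 0)), 0; rewrite //= nrm0.
move=> _ [x /= x1 <-]; apply: le_trans (uC x) _.
by rewrite ler_piMr.
Qed.

End OneMap.

Lemma continuous_linear_bounded (E F : Banach) (u : E -> F) C :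
  (forall (c : K) x y, u (c *: x + y) = c *: u x + u y) ->
  (forall x, nrm (u x) <= C * nrm x) -> continuous_linear u.
Proof.
move=> ul uC; split=> //; apply/continuous_nrmP => x e e0.
have C1 : 0 < `|C| + 1 by rewrite ltr_wpDl.
exists (e / (`|C| + 1)); first by rewrite divr_gt0.
move=> y xy; have -> : u x - u y = u (x - y).
  by rewrite [x - y]addrC -[- y]scaleN1r ul scaleN1r addrC.
apply: le_lt_trans (uC _) _; rewrite ltr_pdivlMr// mulrC in xy.
apply: le_lt_trans xy; rewrite ler_wpM2r ?nrm_ge0//.
by rewrite (le_trans (ler_norm _))// lerDl.
Qed.

Lemma continuous_linear_comp (E F G : Banach) (u : E -> F) (v : F -> G) :
  continuous_linear u -> continuous_linear v -> continuous_linear (v \o u).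
Proof.
move=> [ul uc] [vl vc]; split; first by move=> c x y; rewrite /= ul vl.
by move=> x; apply: continuous_comp; [exact: uc|exact: vc].
Qed.

Lemma continuous_linear_line (F : Banach) (y : F) :
  continuous_linear (fun c : Kb => (c : K) *: y).
Proof.
apply: (@continuous_linear_bounded _ _ _ (nrm y)) => [c a b|c].
  by rewrite scalerDl -scalerA.
by rewrite nrmZ mulrC.
Qed.

End OperatorNorm.

Section ContinuousMultilinear.
Context (R : realType) (kind : scalar_kind).
Local Notation K := (scalar R kind).
Local Notation Kb := (scalar_banach R kind).
Local Notation Banach := (banach R kind).

(** The filter of uniform balls around [z] converges to [z] in the product
    topology, because it does so in each coordinate. *)
Lemma continuous_uniform_ball n (E : 'I_n -> Banach) (F : Banach)
    (T : (forall i, E i) -> F) :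
  continuous (T : prod_topology E -> F) -> forall z (e : R), 0 < e ->
  exists2 r : R, 0 < r &
    forall w, (forall i, nrm (z i - w i) < r) -> nrm (T z - T w) < e.
Proof.
move=> Tc z e e0.
pose D : set_system (forall i, E i) := [set A | exists2 r : R, 0 < r &
  forall w, (forall i, nrm (z i - w i) < r) -> A w].
have FD : Filter D.
  split=> [|A B [r r0 rA] [s s0 sB]|A B AB [r r0 rA]].
  - by exists 1.
  - exists (Num.min r s) => [|w zw]; first by rewrite lt_min r0 s0.
    by split; [apply: rA|apply: sB] => i; have := zw i; rewrite lt_min => /andP[].
  - by exists r => // w /rA /AB.
have Dz : D --> (z : prod_topology E).
  by apply: prod_topology_cvg => i; apply/cvg_nrmP => d d0; exists d => // w; apply.
have TD : T @ D --> T z by apply: cvg_trans (Tc z); exact: cvg_app Dz.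
by move/cvg_nrmP : TD => /(_ _ e0).
Qed.

Section Closure.
Context (n : nat) (E : 'I_n -> Banach) (F : Banach).
Implicit Types S T : (forall i, E i) -> F.

Lemma continuous_multilinear0 : continuous_multilinear (fun _ : forall i, E i => 0 : F).
Proof. by split=> [a i c x y|]; [rewrite scaler0 addr0|exact: cst_continuous]. Qed.

Lemma continuous_multilinearD S T :
  continuous_multilinear S -> continuous_multilinear T ->
  continuous_multilinear (fun x => S x + T x).
Proof.
move=> [Sl Sc] [Tl Tc]; split.
  by move=> a i c x y; rewrite (Sl _ _ c) (Tl _ _ c) scalerDr addrACA.
by move=> x; apply: (@cvgD _ F _ (nbhs x) _ S T _ _ (Sc x) (Tc x)).
Qed.

Lemma continuous_multilinearZ (c : K) T :
  continuous_multilinear T -> continuous_multilinear (fun x => c *: T x).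
Proof.
move=> [Tl Tc]; split; last by move=> x; apply: (@cvgZl_tmp _ F _ (nbhs x) _ c T _ (Tc x)).
by move=> a i d x y; rewrite (Tl _ _ d) scalerDr !scalerA (mulrC c).
Qed.

Lemma continuous_multilinear_sum (J : Type) (s : seq J)
    (T : J -> (forall i, E i) -> F) :
  (forall j, continuous_multilinear (T j)) ->
  continuous_multilinear (fun x => \sum_(j <- s) T j x).
Proof.
move=> Tj; elim: s => [|j s IH].
  by under eq_fun do rewrite big_nil; exact: continuous_multilinear0.
by under eq_fun do rewrite big_cons; exact: continuous_multilinearD.
Qed.

Lemma continuous_multilinear_comp (E0 : 'I_n -> Banach) (F0 : Banach)
    (w : forall i, E0 i -> E i) T (v : F -> F0) :
  (forall i, continuous_linear (w i)) -> continuous_multilinear T ->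
  continuous_linear v ->
  continuous_multilinear (fun x : forall i, E0 i => v (T (fun i => w i (x i)))).
Proof.
move=> wP [Tl Tc] [vl vc]; split=> [a i c x y|].
  have wE (z : E0 i) : (fun j => w j (dfwith a i z j)) =
      dfwith (fun j => w j (a j)) i (w i z).
    by apply: functional_extensionality_dep => j; case: dfwithP => [|k ik];
      rewrite ?dfwithin ?dfwithout.
  by rewrite !wE (wP i).1 (Tl _ _ c) vl.
move=> x; apply: continuous_comp (vc _).
apply: (@continuous_comp (prod_topology E0) (prod_topology E) F
  (fun x i => w i (x i)) T); last exact: Tc.
apply: continuous_into_prod => i z.
by apply: continuous_comp; [exact: continuous_coordinate|exact: (wP i).2].
Qed.

End Closure.

Section FixedVariables.
Context (n : nat) (E : 'I_n.+1 -> Banach) (F : Banach).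

Lemma dfwith_lift (m : 'I_n.+1) (a : forall i, E i) (j : 'I_n) (x : E (lift m j)) :
  (fun i => dfwith a (lift m j) x (lift m i)) =
  dfwith (T := fun i => E (lift m i)) (fun i => a (lift m i)) j x.
Proof.
apply: functional_extensionality_dep => i.
have [<-|ji] := eqVneq j i; first by rewrite !dfwithin.
by rewrite !dfwithout//; apply: contraNneq ji => /lift_inj ->.
Qed.

Lemma dfwith_lift_self (m : 'I_n.+1) (a : forall i, E i) (x : E m) :
  (fun i => dfwith a m x (lift m i)) = (fun i => a (lift m i)).
Proof.
by apply: functional_extensionality_dep => i; rewrite dfwithout// neq_lift.
Qed.

Lemma eq_insert_var (m : 'I_n.+1) (f g : forall i, E i) :
  f m = g m -> (forall i, f (lift m i) = g (lift m i)) -> f = g.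
Proof.
move=> fgm fgl; apply: functional_extensionality_dep => i.
by case: (unliftP m i) => [j|] e; subst i.
Qed.

Lemma insert_var_liftE (m : 'I_n.+1) (a : E m) (x : forall i, E (lift m i)) :
  (fun i => insert_var a x (lift m i)) = x.
Proof. by apply: functional_extensionality_dep => i; rewrite insert_var_lift. Qed.

Lemma insert_var_dfwith (m : 'I_n.+1) (a : E m) (x : forall i, E (lift m i)) i y :
  insert_var a (dfwith x i y) = dfwith (insert_var a x) (lift m i) y.
Proof.
apply: (@eq_insert_var m) => [|j].
  by rewrite dfwithout ?insert_var_at// eq_sym neq_lift.
have := congr1 (fun f => f j) (dfwith_lift (insert_var a x) y) => /= ->.
by rewrite insert_var_liftE insert_var_lift.
Qed.

Lemma insert_varD (m : 'I_n.+1) (a b : E m) (x y : forall i, E (lift m i)) :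
  insert_var (a + b) (fun i => x i + y i) =
  (fun i => insert_var a x i + insert_var b y i).
Proof.
by apply: (@eq_insert_var m) => [|j]; rewrite ?insert_var_at ?insert_var_lift.
Qed.

Lemma fix_var_continuous_multilinear (T : (forall i, E i) -> F) (m : 'I_n.+1)
    (a : E m) : continuous_multilinear T -> continuous_multilinear (fix_var T a).
Proof.
move=> [Tl Tc]; split=> [x i c y z|].
  by rewrite /fix_var !insert_var_dfwith Tl.
move=> x; apply: (@continuous_comp (prod_topology _) (prod_topology E) F
  (insert_var a) T); last exact: Tc.
apply: continuous_into_prod => i; case: (unliftP m i) => [j|] e; subst i.
  rewrite (_ : (fun x => _) = (fun x => x j)); last first.
    by apply/funext => z; rewrite insert_var_lift.
  exact: (@continuous_coordinate _ (fun i => E (lift m i)) j).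
rewrite (_ : (fun x => _) = (fun=> a)); first exact: cst_continuous.
by apply/funext => z; rewrite insert_var_at.
Qed.

End FixedVariables.

Lemma free_var_continuous_linear n (E : 'I_n -> Banach) (F : Banach)
    (T : (forall i, E i) -> F) (a : forall i, E i) (k : 'I_n) :
  continuous_multilinear T -> continuous_linear (free_var T a (k := k)).
Proof.
move=> [Tl Tc]; split=> [c x y|x]; first exact: Tl.
apply: (@continuous_comp _ (prod_topology E) F (dfwith a k) T); last exact: Tc.
exact: dfwith_continuous.
Qed.

End ContinuousMultilinear.

Section FunctionalProducts.
Context (R : realType) (kind : scalar_kind).
Local Notation K := (scalar R kind).
Local Notation Kb := (scalar_banach R kind).
Local Notation Banach := (banach R kind).

Lemma continuous_prod_scale (S : topologicalType) (F : Banach) (I : Type)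
    (s : seq I) (g : I -> S -> Kb) (v : S -> F) :
  (forall i, continuous (g i)) -> continuous v ->
  continuous (fun x => (\prod_(i <- s) (g i x : K)) *: v x).
Proof.
move=> gc vc; elim: s => [|i s IH] x.
  rewrite (_ : (fun x => _) = v); first exact: vc.
  by apply/funext => y; rewrite big_nil scale1r.
rewrite (_ : (fun x => _) =
    fun y => (g i y : K) *: ((\prod_(i <- s) (g i y : K)) *: v y)).
  exact: (@cvgZ _ F _ (nbhs x) _ (g i) _ _ _ (gc i x) (IH x)).
by apply/funext => y; rewrite big_cons scalerA.
Qed.

Lemma functional_prod_continuous_multilinear n (E : 'I_n -> Banach) (F : Banach)
    (phi : forall i, E i -> Kb) (y : F) :
  (forall i, continuous_linear (phi i)) ->
  continuous_multilinear (fun x : forall i, E i => (\prod_i (phi i (x i) : K)) *: y).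
Proof.
move=> phiP; split=> [a k c x z|].
  have prodE (t : E k) : \prod_i (phi i (dfwith a k t i) : K) =
      (phi k t : K) * \prod_(i | i != k) (phi i (a i) : K).
    rewrite (bigD1 k)//= dfwithin; congr (_ * _).
    by apply: eq_bigr => i ik; rewrite dfwithout// eq_sym.
  rewrite !prodE (phiP k).1 scalerA -scalerDl; congr (_ *: _).
  by rewrite mulrDl mulrA.
apply: (@continuous_prod_scale (prod_topology E) F _ (index_enum _)
  (fun i x => phi i (x i)) (fun=> y)); last exact: cst_continuous.
by move=> i x; apply: continuous_comp; [exact: continuous_coordinate|exact: (phiP i).2].
Qed.

Lemma mul_functional_continuous_multilinear k (E : 'I_k.+1 -> Banach) (F : Banach)
    (T : (forall i : 'I_k, E (lift ord_max i)) -> F) (phi : E ord_max -> Kb) :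
  continuous_multilinear T -> continuous_linear phi ->
  continuous_multilinear (mul_functional phi T).
Proof.
move=> [Tl Tc] phiP; split=> [a i c x y|].
  rewrite /mul_functional; case: (unliftP ord_max i) => [j|] e; subst i.
    rewrite !dfwith_lift Tl !dfwithout 1?eq_sym ?neq_lift//.
    by rewrite scalerDr !scalerA mulrC.
  by rewrite !dfwith_lift_self !dfwithin phiP.1 scalerDl -scalerA.
move=> x; apply: (@cvgZ _ F _ (nbhs (x : prod_topology E)) _
  (fun x => phi (x ord_max)) (fun x => T (fun i => x (lift ord_max i)))).
  by apply: continuous_comp; [exact: continuous_coordinate|exact: phiP.2].
apply: (@continuous_comp (prod_topology E)
  (prod_topology (fun i => E (lift ord_max i))) F
  (fun x i => x (lift ord_max i)) T); last exact: Tc.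
by apply: continuous_into_prod => i; exact: continuous_coordinate.
Qed.

Lemma mul_functionals_continuous_multilinear n (E : 'I_n.+1 -> Banach) (F : Banach)
    (u : E ord_max -> F) (phi : forall i : 'I_n, E (lift ord_max i) -> Kb) :
  continuous_linear u -> (forall i, continuous_linear (phi i)) ->
  continuous_multilinear (mul_functionals phi u).
Proof.
move=> uP phiP; split=> [a i c x y|].
  rewrite /mul_functionals; case: (unliftP ord_max i) => [j|] e; subst i.
    rewrite !dfwithout 1?eq_sym ?neq_lift//.
    pose b := fun i => a (lift ord_max i).
    have prodE (t : E (lift ord_max j)) :
        \prod_i (phi i (dfwith a (lift ord_max j) t (lift ord_max i)) : K) =
        \prod_i (phi i (dfwith b j t i) : K).
      by rewrite -(dfwith_lift a t).
    rewrite !prodE.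
    have [pl _] := functional_prod_continuous_multilinear (u (a ord_max)) phiP.
    exact: (pl b j c x y).
  have prodE t :
      \prod_i (phi i (dfwith a ord_max t (lift ord_max i)) : K) =
      \prod_i (phi i (a (lift ord_max i)) : K).
    by apply: eq_bigr => i _; rewrite dfwithout// neq_lift.
  by rewrite !prodE !dfwithin uP.1 scalerDr !scalerA mulrC.
apply: (@continuous_prod_scale (prod_topology E) F _ (index_enum _)
  (fun i x => phi i (x (lift ord_max i))) (fun x => u (x ord_max))).
  by move=> i x; apply: continuous_comp; [exact: continuous_coordinate|exact: (phiP i).2].
by move=> x; apply: continuous_comp; [exact: continuous_coordinate|exact: uP.2].
Qed.

(** * Continuous polynomials *)

(** Averaging any multilinear map that induces the polynomial over the
    permutations of its variables makes it symmetric. *)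
Lemma polar_spec n (E F : Banach) (P : E -> F) : continuous_polynomial n P ->
  [/\ continuous_multilinear (E := fun _ : 'I_n => E) (polar P),
      symmetric_map (polar (n := n) P) & forall x, P x = polar (n := n) P (fun=> x)].
Proof.
move=> [T TP PT]; rewrite /polar; case: xgetP => [S -> //|noS]; exfalso.
pose S x := (n`!%:R^-1 : K) *: \sum_(s : 'S_n) T (fun i => x (s i)).
apply: (noS S); split.
- apply: continuous_multilinearZ; apply: continuous_multilinear_sum => s.
  split; first exact: multilinear_perm TP.1.
  move=> x; apply: (@continuous_comp (prod_topology (fun _ : 'I_n => E))
    (prod_topology (fun _ : 'I_n => E)) F (fun x i => x (s i)) T); last exact: TP.2.
  apply: continuous_into_prod => i.
  exact: (@continuous_coordinate _ (fun _ : 'I_n => E) (s i)).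
- move=> s x; rewrite /S; congr (_ *: _).
  rewrite [RHS](reindex_inj (mulIg s)); apply: eq_bigr => t _; congr T.
  by apply/funext => i; rewrite permM.
- move=> x; rewrite PT /S sumr_const card_Sn -[X in _ *: X]scaler_nat scalerA mulVf ?scale1r//.
  by rewrite pnatr_eq0 -lt0n fact_gt0.
Qed.

Section Closure.
Context (n : nat) (E F : Banach).
Implicit Types P Q : E -> F.

Lemma continuous_polynomial0 : continuous_polynomial n (fun _ : E => 0 : F).
Proof. by exists (fun=> 0) => //; exact: continuous_multilinear0. Qed.

Lemma continuous_polynomialD P Q :
  continuous_polynomial n P -> continuous_polynomial n Q ->
  continuous_polynomial n (fun x => P x + Q x).
Proof.
move=> [S SP PS] [T TP QT]; exists (fun x => S x + T x).
  exact: continuous_multilinearD.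
by move=> x; rewrite PS QT.
Qed.

Lemma continuous_polynomialZ (c : K) P :
  continuous_polynomial n P -> continuous_polynomial n (fun x => c *: P x).
Proof.
move=> [S SP PS]; exists (fun x => c *: S x); first exact: continuous_multilinearZ.
by move=> x; rewrite PS.
Qed.

Lemma continuous_polynomial_comp (E0 F0 : Banach) (w : E0 -> E) P (v : F -> F0) :
  continuous_linear w -> continuous_polynomial n P -> continuous_linear v ->
  continuous_polynomial n (v \o P \o w).
Proof.
move=> wP [T TP PT] vP; exists (fun x => v (T (fun i => w (x i)))).
  exact: (@continuous_multilinear_comp _ _ _ (fun=> E) F (fun=> E0) F0 (fun=> w)
    T v (fun=> wP) TP vP).
by move=> x; rewrite /= PT.
Qed.

Lemma continuous_polynomial_power (phi : E -> Kb) (y : F) :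
  continuous_linear phi -> continuous_polynomial n (fun x => (phi x : K) ^+ n *: y).
Proof.
move=> phiP.
exists (fun x : 'I_n -> E => (\prod_i (phi (x i) : K)) *: y).
  exact: (@functional_prod_continuous_multilinear n (fun=> E) F (fun=> phi) y (fun=> phiP)).
by move=> x; rewrite prodr_const card_ord.
Qed.

Lemma continuous_polynomial_mul_functional P (phi : E -> Kb) :
  continuous_polynomial n P -> continuous_linear phi ->
  continuous_polynomial n.+1 (poly_mul_functional 1 phi P).
Proof.
move=> [T TP PT] phiP.
exists (mul_functional (E := fun _ : 'I_n.+1 => E) phi T).
  exact: mul_functional_continuous_multilinear.
by move=> x; rewrite /mul_functional -PT.
Qed.

Lemma continuous_polynomial_power_linear (u : E -> F) (phi : E -> Kb) :
  continuous_linear u -> continuous_linear phi ->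
  continuous_polynomial n.+1 (poly_mul_functional n phi u).
Proof.
move=> uP phiP.
exists (mul_functionals (E := fun _ : 'I_n.+1 => E) (fun=> phi) u).
  exact: mul_functionals_continuous_multilinear.
by move=> x; rewrite /mul_functionals prodr_const card_ord.
Qed.

End Closure.
End FunctionalProducts.

(** * Uniform boundedness *)

Section UniformBoundedness.
Context (R : realType) (kind : scalar_kind).
Local Notation K := (scalar R kind).
Local Notation Banach := (banach R kind).

(** This is the Baire category theorem for a product of Banach spaces with the
    topology of uniform balls. If no [A m] contained a ball, one could choose
    nested balls of radii tending to 0, the [m]-th disjoint from [A m]; their
    common point, which exists by completeness of each factor, would lie in no
    [A m]. *)
Lemma baire_uniform_ball (I : Type) (E : I -> Banach) (A : nat -> set (forall i, E i)) :
  (forall m z, ~ A m z -> exists2 r : R, 0 < r &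
     forall w, (forall i, nrm (z i - w i) <= r) -> ~ A m w) ->
  (forall z, exists m, A m z) ->
  exists m (c : forall i, E i) (r : R), 0 < r /\
    forall w, (forall i, nrm (c i - w i) <= r) -> A m w.
Proof.
move=> Aclosed Acover; apply: contrapT => noball.
pose T := ((forall i, E i) * R)%type.
pose ball (b : T) : set (forall i, E i) :=
  [set w | forall i, nrm (b.1 i - w i) <= b.2].
have step (mb : nat * T) : exists b' : T, 0 < mb.2.2 ->
    [/\ 0 < b'.2, b'.2 <= mb.1.+1%:R^-1, ball b' `<=` ball mb.2 &
        forall w, ball b' w -> ~ A mb.1 w].
  case: mb => m [c r] /=; have [r0|r0] := ltP 0 r; last first.
    by exists (c, r).
  have [w [cw Aw]] : exists w, ball (c, r / 2) w /\ ~ A m w.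
    apply: contrapT => now; apply: noball; exists m, c, (r / 2); split.
      by rewrite divr_gt0.
    by move=> w cw; apply: contrapT => Aw; apply: now; exists w.
  have [s s0 sA] := Aclosed _ _ Aw.
  (* radius at most [r / 2] for nesting, at most [1 / (m + 1)] for shrinking *)
  exists (w, Num.min s (Num.min (r / 2) m.+1%:R^-1)) => _; split=> /=.
  - by rewrite !lt_min s0 divr_gt0//= invr_gt0 ltr0n.
  - by rewrite !ge_min lexx !orbT.
  - move=> v wv i; move: (wv i) (cw i); rewrite /= !le_min => /and3P[_ wvi _] cwi.
    rewrite (splitr r) (le_trans _ (lerD cwi wvi))// (le_trans _ (ler_nrmD _ _))//.
    by rewrite addrA subrK.
  - by move=> v wv; apply: sA => i; move: (wv i); rewrite /= !le_min => /and3P[].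
have {step}[f fP] := choice step.
pose b := fix b m : T := if m is k.+1 then f (k, b k) else (fun=> 0, 1).
have b0 m : 0 < (b m).2 by elim: m => [|m IH]; [exact: ltr01|have [] := fP (m, b m) IH].
have bsub p q : (p <= q)%N -> ball (b q) `<=` ball (b p).
  elim: q => [|q IH]; first by rewrite leqn0 => /eqP ->.
  rewrite leq_eqVlt => /predU1P[-> //|]; rewrite ltnS => /IH.
  by apply: subset_trans; have [] := fP (q, b q) (b0 q).
have bself m : ball (b m) (b m).1.
  by move=> i; rewrite subrr nrm0 ltW.
have bsmall (e : R) : 0 < e -> exists N, (b N).2 < e.
  move=> e0; have e'0 : 0 <= e^-1 by rewrite invr_ge0 ltW.
  have {e'0} /archi_boundP := e'0; set N := Num.bound _ => Ne.
  have [_ bN _ _] := fP (N, b N) (b0 N).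
  exists N.+1; apply: le_lt_trans bN _; rewrite invf_plt ?posrE//.
  by rewrite (lt_trans Ne)// ltr_nat.
have lim i : exists l : E i, forall e : R, 0 < e ->
    exists N, forall p, (N <= p)%N -> nrm (l - (b p).1 i) < e.
  apply: cauchy_nrm_cvg => e e0.
  have [|N Ne] := bsmall (e / 2); first by rewrite divr_gt0.
  exists N => p q Np Nq.
  have := bsub _ _ Np _ (bself p) i; have := bsub _ _ Nq _ (bself q) i.
  move=> h1 h2; rewrite (splitr e).
  apply: le_lt_trans (ltrD (le_lt_trans h2 Ne) (le_lt_trans h1 Ne)).
  by rewrite [X in _ <= X + _]nrmBC (le_trans _ (ler_nrmD _ _))// addrA subrK.
pose l i := projT1 (cid (lim i)).
have lP i (e : R) : 0 < e -> exists N, forall p, (N <= p)%N -> nrm (l i - (b p).1 i) < e.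
  by rewrite /l; case: cid => /= x; apply.
have lin m : ball (b m) l.
  move=> i; apply/ler_addgt0Pr => e e0; have [N Ne] := lP i e e0.
  have := bsub _ _ (leq_maxl m N) _ (bself (maxn m N)) i.
  have := Ne _ (leq_maxr m N); set c := (b (maxn m N)).1 i => h1 h2.
  rewrite (le_trans _ (lerD h2 (ltW h1)))// [X in _ <= _ + X]nrmBC.
  by rewrite (le_trans _ (ler_nrmD _ _))// addrA subrK.
have [m Am] := Acover l.
by have [_ _ _ /(_ l (lin m.+1))] := fP (m, b m) (b0 m).
Qed.

(** Uniform boundedness: the sets where the norm of [T] is at most [m] are
    closed and cover the product, hence one of them contains a ball. The ball
    is moved to the origin one coordinate at a time, each move costing a factor
    2, since [w = (c + w) - c]. *)
Lemma multilinear_lsc_bounded n (E : 'I_n -> Banach) (F : Banach)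
    (T : (forall i, E i) -> F) :
  multilinear T ->
  (forall z (M : R), M < nrm (T z) -> exists2 r : R, 0 < r &
     forall w, (forall i, nrm (z i - w i) <= r) -> M < nrm (T w)) ->
  exists2 C : R, 0 < C & forall z, nrm (T z) <= C * \prod_i nrm (z i).
Proof.
move=> Tl Tlsc.
have [m [c [r [r0 cr]]]] : exists m (c : forall i, E i) (r : R), 0 < r /\
    forall w, (forall i, nrm (c i - w i) <= r) -> nrm (T w) <= m%:R.
  apply: (@baire_uniform_ball _ E (fun m => [set z | nrm (T z) <= m%:R])).
    move=> m z /= /negP; rewrite -ltNge => /Tlsc[r r0 rT].
    by exists r => // w /rT; rewrite ltNge => /negP.
  move=> z; exists (Num.bound (nrm (T z))) => /=.
  exact/ltW/archi_boundP/nrm_ge0.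
have origin w : (forall i, nrm (w i) <= r) -> nrm (T w) <= 2 ^+ n * m%:R.
  move=> wr.
  suff H s c' : uniq s -> (forall i, nrm (c i - c' i) <= r) ->
      nrm (T (mix w c' s)) <= 2 ^+ size s * m%:R.
    have := H (enum 'I_n) c (enum_uniq _); rewrite mix_enum size_enum_ord; apply.
    by move=> i; rewrite subrr nrm0 ltW.
  elim: s c' => [c' _ cc'|k s IH c' /andP[ks us] cc'].
    by rewrite mix_nil expr0 mul1r; exact: cr.
  have -> : T (mix w c' (k :: s)) = T (mix w (dfwith c' k (c k + w k)) s) -
                                    T (mix w (dfwith c' k (c k)) s).
    rewrite mix_cons -!mix_dfwith//; apply/eqP; rewrite eq_sym subr_eq.
    by rewrite -(multilinearD Tl) addrC.
  apply: le_trans (ler_nrmB _ _) _; rewrite exprS -mulrA mulr_natl mulr2n.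
  apply: lerD; apply: IH => // i; case: dfwithP => //; rewrite ?subrr ?nrm0 ?(ltW r0)//.
  by rewrite opprD addNKr nrmN.
exists (2 ^+ n * (m%:R + 1) / r ^+ n).
  by rewrite divr_gt0 ?exprn_gt0// mulr_gt0 ?exprn_gt0// ltr_wpDl.
move=> z; have [/existsP[i /eqP zi]|] := boolP [exists i, z i == 0].
  rewrite (multilinear_eq0 Tl zi) nrm0 mulr_ge0//.
    by rewrite divr_ge0 ?exprn_ge0 ?(ltW r0)// mulr_ge0 ?exprn_ge0 ?addr_ge0.
  by rewrite prodr_ge0// => j _; exact: nrm_ge0.
rewrite negb_exists => /forallP z0.
have zgt0 i : 0 < nrm (z i).
  by rewrite lt_def nrm_ge0 andbT; apply: contra (z0 i) => /eqP/nrm_eq0/eqP.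
pose w i := of_real kind (r / nrm (z i)) *: z i.
have wr i : nrm (w i) <= r.
  by rewrite nrmZ nrm_of_real ?divr_ge0 ?(ltW r0) ?nrm_ge0// divfK// gt_eqF.
have {1}-> : z = fun i => of_real kind (nrm (z i) / r) *: w i.
  apply: functional_extensionality_dep => i; rewrite /w scalerA -of_realM.
  by rewrite mulrA divfK ?gt_eqF// divff ?gt_eqF// of_real1 scale1r.
rewrite (multilinear_scale Tl) nrmZ nrm_prod.
have -> : \prod_i nrm (of_real kind (nrm (z i) / r) : scalar_banach R kind) =
    (\prod_i nrm (z i)) / r ^+ n.
  under eq_bigr do rewrite nrm_of_real ?divr_ge0 ?nrm_ge0 ?(ltW r0)//.
  by rewrite big_split/= prodr_const card_ord exprVn.
rewrite mulrAC [X in _ <= X]mulrC mulrA; apply: ler_wpM2r.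
  by rewrite invr_ge0 exprn_ge0// ltW.
apply: ler_wpM2l; first by apply: prodr_ge0 => i _; exact: nrm_ge0.
apply: le_trans (origin w wr) _.
by rewrite ler_wpM2l ?exprn_ge0// lerDl.
Qed.


End UniformBoundedness.

(** * Sequence classes *)

Section SequenceClassTheory.
Context (R : realType) (kind : scalar_kind).
Local Notation K := (scalar R kind).
Local Notation Kb := (scalar_banach R kind).
Local Notation Banach := (banach R kind).

(** Membership and a bound on the norm travel together, since the value of
    [sc_norm] is meaningful for members only. *)
Definition sc_in (g : sequence_class R kind) (E : Banach) (C : R) (x : nat -> E) :
    Prop :=
  sc_mem g x /\ sc_norm g x <= C.

Definition single (E : Banach) (k : nat) (y : E) : nat -> E :=
  fun j => if j == k then y else 0.

Section OneClass.
Variable g : sequence_class R kind.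
Implicit Types E F : Banach.

Lemma sc_norm_ge0 E (x : nat -> E) : 0 <= sc_norm g x.
Proof. exact: nrm_ge0. Qed.

Lemma sc_in_norm E (x : nat -> E) : sc_mem g x -> sc_in g (sc_norm g x) x.
Proof. by []. Qed.

Lemma sc_in_le E C C' (x : nat -> E) : C <= C' -> sc_in g C x -> sc_in g C' x.
Proof. by move=> CC' [xg xC]; split=> //; exact: le_trans CC'. Qed.

Lemma sc_in0 E : sc_in g 0 (fun=> 0 : E).
Proof.
rewrite (_ : (fun=> 0) = sc_seq g E 0); last by rewrite linear0.
by split; [exists 0|rewrite sc_normE nrm0].
Qed.

Lemma sc_inD E C C' (x y : nat -> E) :
  sc_in g C x -> sc_in g C' y -> sc_in g (C + C') (fun j => x j + y j).
Proof.
move=> [[s _ <-] sC] [[t _ <-] tC].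
rewrite (_ : (fun j => _) = sc_seq g E (s + t)); last by rewrite linearD.
split; first by exists (s + t).
by rewrite !sc_normE in sC tC *; rewrite (le_trans (ler_nrmD _ _))// lerD.
Qed.

Lemma sc_normZ E (c : K) (x : nat -> E) : sc_mem g x ->
  sc_mem g (fun j => c *: x j) /\
  sc_norm g (fun j => c *: x j) = nrm (c : Kb) * sc_norm g x.
Proof.
move=> [s _ <-].
rewrite (_ : (fun j => _) = sc_seq g E (c *: s)); last by rewrite linearZ.
by split; [exists (c *: s)|rewrite !sc_normE nrmZ].
Qed.

Lemma sc_inZ E C (c : K) (x : nat -> E) :
  sc_in g C x -> sc_in g (nrm (c : Kb) * C) (fun j => c *: x j).
Proof.
move=> [xg xC]; have [h1 h2] := sc_normZ c xg; split=> //.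
by rewrite h2 ler_wpM2l// nrm_ge0.
Qed.

Lemma sc_mem_sum E (J : Type) (s : seq J) (x : J -> nat -> E) :
  (forall i, sc_mem g (x i)) -> sc_mem g (fun j => \sum_(i <- s) x i j).
Proof.
move=> xg; elim: s => [|i s IH].
  by under eq_fun do rewrite big_nil; exact: (sc_in0 E).1.
under eq_fun do rewrite big_cons.
exact: (sc_inD (sc_in_norm (xg i)) (sc_in_norm IH)).1.
Qed.

Lemma nrm_le_sc_norm E (x : nat -> E) j : sc_mem g x -> nrm (x j) <= sc_norm g x.
Proof.
move=> [s _ <-]; have [ub le] := sc_linf s; rewrite sc_normE.
by apply: le_trans le; apply: ub_le_sup => //; exists j.
Qed.

Lemma sc_mem_fin E N (x : nat -> E) :
  (forall j, (N <= j)%N -> x j = 0) -> sc_mem g x.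
Proof. by move=> xN; apply: sc_c00; exists N. Qed.

Lemma sc_mem_truncate E k (x : nat -> E) : sc_mem g (truncate k x).
Proof. by apply: (@sc_mem_fin _ k) => j kj; rewrite /truncate ltnNge kj. Qed.

Lemma sc_norm_unit j : sc_norm g (@unit_seq R kind j) = 1.
Proof.
have [s _ sj] : sc_mem g (@unit_seq R kind j).
  by apply: (@sc_mem_fin _ j.+1) => i ji; rewrite /unit_seq gtn_eqF.
by rewrite -sj sc_normE (sc_unit sj).
Qed.

Hypothesis gls : linearly_stable g.

Lemma sc_in_linear E F (u : E -> F) C (x : nat -> E) :
  continuous_linear u -> sc_in g C x -> sc_in g (opnorm u * C) (u \o x).
Proof.
move=> uP [[s _ <-] sC]; have [v [vu vP vn]] := gls uP.
rewrite -vu; split; first by exists (v s).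
rewrite sc_normE (le_trans (nrm_le_opnorm vP _))// vn.
by rewrite ler_wpM2l ?opnorm_ge0// -sc_normE.
Qed.

Lemma sc_in_line F C (x : nat -> Kb) (y : F) :
  sc_in g C x -> sc_in g (C * nrm y) (fun j => (x j : K) *: y).
Proof.
move=> xC; have lP := continuous_linear_line y.
apply: sc_in_le (sc_in_linear lP xC).
rewrite mulrC ler_wpM2l//; first by rewrite (le_trans (sc_norm_ge0 x)) ?xC.2.
by apply: opnorm_le => [|c]; rewrite ?nrm_ge0// nrmZ mulrC.
Qed.

(** The sequence is the image of a scalar unit sequence, of norm 1, under the
    linear map [c |-> c *: y]. *)
Lemma sc_in_single F k (y : F) : sc_in g (nrm y) (single k y).
Proof.
have uC : sc_in g 1 (@unit_seq R kind k).
  split; last by rewrite sc_norm_unit.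
  by apply: (@sc_mem_fin _ k.+1) => i ji; rewrite /unit_seq gtn_eqF.
rewrite -[nrm y]mul1r (_ : single k y = fun j => (unit_seq R kind k j : K) *: y).
  exact: sc_in_line.
apply/funext => j; rewrite /single /unit_seq.
by case: eqP; rewrite ?scale1r ?scale0r.
Qed.

Lemma truncateS E k (x : nat -> E) :
  truncate k.+1 x = fun j => truncate k x j + single k (x k) j.
Proof.
apply/funext => j; rewrite /truncate /single ltnS leq_eqVlt.
by case: eqP => [->|_]; rewrite ?ltnn ?add0r ?addr0.
Qed.

Hypothesis gfd : finitely_determined g.

Lemma sc_norm_truncate_le E k (x : nat -> E) :
  sc_mem g x -> sc_norm g (truncate k x) <= sc_norm g x.
Proof.
move=> xg; have [h1 h2] := gfd x; rewrite (h2 xg); apply: ub_le_sup; first exact/h1.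
by exists k.
Qed.

Lemma sc_norm_truncate_gt E (x : nat -> E) M :
  sc_mem g x -> M < sc_norm g x -> exists k, M < sc_norm g (truncate k x).
Proof.
move=> xg; have [h1 h2] := gfd x; rewrite (h2 xg) => /sup_gt[].
  by exists (sc_norm g (truncate 0 x)), 0%N.
by move=> _ [k _ <-] Mk; exists k.
Qed.

End OneClass.

(** ** Products of scalar sequences and vector sequences *)

Section Products.
Variable g : sequence_class R kind.
Hypotheses (gls : linearly_stable g) (gK : K_closed g).

Lemma sc_in_mul (F : Banach) C D (x : nat -> Kb) (y : nat -> F) :
  sc_in g C x -> sc_in g D y -> sc_in g (C * D) (fun j => (x j : K) *: y j).
Proof.
move=> [xg xC] [yg yD]; have [h1 h2] := gK xg yg; split=> //.
by apply: le_trans h2 _; rewrite ler_pM ?sc_norm_ge0.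
Qed.

(** The bound is the increment of a product of two nonnegative reals; in this
    form, unlike [(A + X) * (Q + D)], it can be iterated without loss. *)
Lemma sc_in_product (F : Banach) (c : Kb) (xi : nat -> Kb) (v : F) (w : nat -> F)
    (A X Q D : R) :
  nrm c <= A -> sc_in g X xi -> nrm v <= Q -> sc_in g D w ->
  sc_in g ((A + X) * (Q + D) - A * Q)
    (fun j => (c + xi j : K) *: (v + w j) - (c : K) *: v).
Proof.
move=> cA xiX vQ wD.
have D0 : 0 <= D := le_trans (sc_norm_ge0 _ _) wD.2.
have X0 : 0 <= X := le_trans (sc_norm_ge0 _ _) xiX.2.
have -> : (fun j => (c + xi j : K) *: (v + w j) - (c : K) *: v) =
    fun j => (c : K) *: w j + ((xi j : K) *: v + (xi j : K) *: w j).
  by apply/funext => j; rewrite scalerDl !scalerDr addrAC [X in X - _]addrC addrK.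
rewrite (_ : _ - _ = A * D + (X * Q + X * D)); last by ring.
apply: sc_inD; first by apply: sc_in_le (sc_inZ c wD); rewrite ler_wpM2r.
apply: sc_inD; last exact: sc_in_mul.
by apply: sc_in_le (sc_in_line gls v xiX); rewrite ler_wpM2l.
Qed.

Lemma sc_in_products (F : Banach) (I : Type) (s : seq I) (c : I -> Kb)
    (xi : I -> nat -> Kb) (v : F) (w : nat -> F) (A X : I -> R) (Q D : R) :
  (forall i, nrm (c i) <= A i) -> (forall i, sc_in g (X i) (xi i)) ->
  nrm v <= Q -> sc_in g D w ->
  sc_in g (\prod_(i <- s) (A i + X i) * (Q + D) - (\prod_(i <- s) A i) * Q)
    (fun j => (\prod_(i <- s) (c i + xi i j : K)) *: (v + w j) -
              (\prod_(i <- s) (c i : K)) *: v).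
Proof.
move=> cA xiX vQ wD; elim: s => [|i s IH].
  rewrite !big_nil !mul1r addrC addKr.
  by under eq_fun do rewrite !big_nil !scale1r addrC addKr.
have A0 j : 0 <= A j := le_trans (nrm_ge0 _) (cA j).
have vQ' : nrm ((\prod_(i <- s) (c i : K)) *: v) <= (\prod_(i <- s) A i) * Q.
  rewrite nrmZ nrm_prod ler_pM ?nrm_ge0 ?prodr_ge0//.
    by move=> j _; exact: nrm_ge0.
  by apply: ler_prod => j _; rewrite nrm_ge0 cA.
have := sc_in_product (cA i) (xiX i) vQ' IH; rewrite !big_cons.
rewrite [X in _ -> sc_in _ X _](_ : _ = (A i + X i) *
  ((\prod_(j <- s) A j) * Q + ((\prod_(j <- s) (A j + X j)) * (Q + D) -
  (\prod_(j <- s) A j) * Q)) - A i * ((\prod_(j <- s) A j) * Q)); last by ring.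
congr sc_in; apply/funext => j; rewrite !big_cons -!scalerA; congr (_ *: _ - _).
by rewrite addrC subrK.
Qed.

End Products.

(** ** The least constant in an inequality *)

Section BestConstant.
Context (I : Type) (D : set I) (p w : I -> R).

Definition best_const : R :=
  inf [set C | 0 < C /\ forall i, D i -> p i <= C * w i].

Lemma best_const_ge0 : 0 <= best_const.
Proof.
rewrite /best_const; set S := [set _ | _].
have [->|/set0P S0] := eqVneq S set0; first by rewrite inf0.
by apply: lb_le_inf => // C [/ltW].
Qed.

Lemma best_const_le C :
  0 <= C -> (forall i, D i -> p i <= C * w i) -> (forall i, D i -> 0 <= w i) ->
  best_const <= C.
Proof.
move=> C0 pC w0; apply/ler_addgt0Pr => e e0; apply: ge_inf.
  by exists 0 => c [/ltW].
split; first by rewrite ltr_wpDl.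
move=> i Di; rewrite (le_trans (pC i Di))// ler_wpM2r ?w0//.
by rewrite lerDl ltW.
Qed.

Lemma best_constP : (forall i, D i -> 0 <= w i) ->
  (exists2 C, 0 < C & forall i, D i -> p i <= C * w i) ->
  forall i, D i -> p i <= best_const * w i.
Proof.
move=> w0 [C C0 pC] i Di.
have [wi|wi] := eqVneq (w i) 0; first by have := pC i Di; rewrite wi !mulr0.
have wgt0 : 0 < w i by rewrite lt_def wi w0.
rewrite -ler_pdivrMr//; apply: lb_le_inf; first by exists C.
by move=> c [_ pc]; rewrite ler_pdivrMr// pc.
Qed.

End BestConstant.

(** Summing operators, polynomials and multilinear maps are all defined through
    linear operations [L i] that turn a map into the sequence of its
    increments. *)
Lemma normed_subspace_best_const (g : sequence_class R kind) (X : Type) (F : Banach)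
    (A Q : set (X -> F)) (N : (X -> F) -> R) (I : Type) (D : set I)
    (L : I -> (X -> F) -> nat -> F) (w : I -> R) :
  (forall f, A f <-> Q f /\ forall i, D i -> sc_mem g (L i f)) ->
  (forall f, N f = best_const D (fun i => sc_norm g (L i f)) w) ->
  Q (fun=> 0) ->
  (forall f h, Q f -> Q h -> Q (fun x => f x + h x)) ->
  (forall (c : K) f, Q f -> Q (fun x => c *: f x)) ->
  (forall i, L i (fun=> 0) = fun=> 0) ->
  (forall i f h, L i (fun x => f x + h x) = fun j => L i f j + L i h j) ->
  (forall i (c : K) f, L i (fun x => c *: f x) = fun j => c *: L i f j) ->
  (forall i, D i -> 0 <= w i) ->
  (forall f, A f -> exists2 C, 0 < C & forall i, D i -> sc_norm g (L i f) <= C * w i) ->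
  (forall f, A f -> (forall i, D i -> sc_norm g (L i f) <= 0) -> f = fun=> 0) ->
  normed_subspace A N.
Proof.
move=> AE NE Q0 QD QZ L0 LD LZ w0 Abd Adef.
have AP f : A f -> 0 <= N f /\
    forall i, D i -> sc_in g (N f * w i) (L i f).
  move=> Af; rewrite NE; split; first exact: best_const_ge0.
  move=> i Di; split; first by apply: ((AE f).1 Af).2.
  exact: (best_constP w0 (Abd f Af)).
have Nle f C : 0 <= C -> (forall i, D i -> sc_norm g (L i f) <= C * w i) -> N f <= C.
  by move=> C0 fC; rewrite NE; exact: best_const_le.
have AZ (c : K) f : A f -> A (fun x => c *: f x).
  move=> /AE[Qf Lf]; apply/AE; split; first exact: QZ.
  by move=> i Di; rewrite LZ; exact: (sc_normZ c (Lf i Di)).1.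
have NZ (c : K) f : A f -> N (fun x => c *: f x) <= nrm (c : Kb) * N f.
  move=> Af; have [N0 Nf] := AP f Af.
  apply: Nle => [|i Di]; first by rewrite mulr_ge0// nrm_ge0.
  by rewrite LZ -mulrA; exact: (sc_inZ c (Nf i Di)).2.
split.
- by apply/AE; split=> // i Di; rewrite L0; exact: (sc_in0 g F).1.
- move=> f h Af Ah; have [Nf0 Nf] := AP f Af; have [Nh0 Nh] := AP h Ah.
  have fh i : D i -> sc_in g ((N f + N h) * w i) (L i (fun x => f x + h x)).
    by move=> Di; rewrite LD mulrDl; apply: sc_inD; [exact: Nf|exact: Nh].
  split; last by apply: Nle => [|i /fh[]//]; rewrite addr_ge0.
  apply/AE; split; last by move=> i /fh[].
  by apply: QD; [have /AE[] := Af|have /AE[] := Ah].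
- move=> c f Af; split; first exact: AZ.
  apply/eqP; rewrite eq_le NZ//=.
  have [->|c0] := eqVneq c 0.
    by rewrite (nrm0 Kb) mul0r NE best_const_ge0.
  have c0' : 0 < nrm (c : Kb).
    by rewrite lt_def nrm_ge0 andbT; apply: contra c0 => /eqP/nrm_eq0 ->.
  have := NZ c^-1 _ (AZ c f Af).
  under [X in N X <= _]eq_fun do rewrite scalerA mulVf// scale1r.
  rewrite -(ler_pM2l c0') mulrA -nrmM divff// nrm1 mul1r.
  done.
- move=> f Af; have [Nf0 Nf] := AP f Af; split=> // Nf00.
  by apply: Adef => // i Di; have := (Nf i Di).2; rewrite Nf00 mul0r.
Qed.

End SequenceClassTheory.

(** * Summing maps *)

Section Summing.
Context (R : realType) (kind : scalar_kind).
Local Notation K := (scalar R kind).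
Local Notation Kb := (scalar_banach R kind).
Local Notation Banach := (banach R kind).
Variables gs gs1 : sequence_class R kind.
Hypotheses (gsfd : finitely_determined gs)
  (gsls : linearly_stable gs).

(** ** Boundedness of summing multilinear maps *)

Lemma dfwith_image (I : eqType) (Z E : I -> Type) (G : forall i, Z i -> E i)
    (z : forall i, Z i) k (u : Z k) :
  (fun i => G i (dfwith z k u i)) = dfwith (fun i => G i (z i)) k (G k u).
Proof.
by apply: functional_extensionality_dep => i; case: dfwithP => [|j kj];
  rewrite ?dfwithin ?dfwithout.
Qed.

(** The increments of [T] are a multilinear function of the pairs formed by a
    point [a i] and an element of the Banach space of sequences over [E i]. Its
    norm is a supremum of the continuous norms of the truncations, so the
    uniform boundedness principle applies. *)
Lemma ev_multi_bounded n (E : 'I_n -> Banach) (F : Banach)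
    (T : (forall i, E i) -> F) :
  ev_multi_mem gs gs1 T ->
  exists2 C, 0 < C & forall (a : forall i, E i) (x : forall i, nat -> E i),
    (forall i, sc_mem gs1 (x i)) ->
    sc_norm gs (multi_increments T a x) <=
      C * \prod_i (nrm (a i) + sc_norm gs1 (x i)).
Proof.
move=> [[Tl Tc] Tmem].
pose Z i := prod_banach (E i) (sc_space gs1 (E i)).
pose pt (z : forall i, Z i) i : E i := (z i).1.
pose sq (z : forall i, Z i) i : nat -> E i := sc_seq gs1 (E i) (z i).2.
pose inc z := multi_increments T (pt z) (sq z).
have incg z : sc_mem gs (inc z) by apply: Tmem => i; exists (z i).2.
pose Psi z : sc_space gs F := projT1 (cid2 (incg z)).
have PsiE z : sc_seq gs F (Psi z) = inc z by rewrite /Psi; case: cid2.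
have Psin z : nrm (Psi z) = sc_norm gs (inc z) by rewrite -PsiE sc_normE.
have incj z j : inc z j = T (fun i => (z i).1 + sc_seq gs1 (E i) (z i).2 j) -
                          T (fun i => (z i).1) by [].
have Psil : multilinear (E := Z) Psi.
  move=> z k c u v; apply: (@sc_inj _ _ gs F); rewrite linearP !PsiE.
  apply/funext => j; rewrite -[RHS]/(c *: inc _ j + inc _ j) !incj.
  pose G i (t : Z i) : E i := t.1 + sc_seq gs1 (E i) t.2 j.
  pose H i (t : Z i) : E i := t.1.
  have GE t := dfwith_image G z t; have HE t := dfwith_image H z t.
  rewrite {}/G {}/H in GE HE; rewrite !GE !HE.
  rewrite /= linearP/=.
  rewrite -[(c *: sc_seq _ _ u.2 + _) j]/(c *: sc_seq gs1 (E k) u.2 j + sc_seq gs1 (E k) v.2 j).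
  rewrite addrACA -scalerDr !Tl scalerBr opprD addrACA.
  by [].
have small k z (e : R) : 0 < e -> exists2 r : R, 0 < r &
    forall w, (forall i, nrm (z i - w i) <= r) ->
      sc_norm gs (truncate k (fun j => inc z j - inc w j)) <= e.
  elim: k e => [|k IH] e e0.
    exists 1 => // w _; rewrite (_ : truncate 0 _ = fun=> 0)//.
    by rewrite (le_trans (sc_in0 gs F).2)// ltW.
  have e2 : 0 < e / 2 by rewrite divr_gt0.
  have e4 : 0 < e / 2 / 2 by rewrite divr_gt0.
  have [r r0 rP] := IH _ e2.
  have [r1 r10 r1P] := continuous_uniform_ball Tc
    (fun i => (z i).1 + sc_seq gs1 (E i) (z i).2 k) e4.
  have [r2 r20 r2P] := continuous_uniform_ball Tc (pt z) e4.
  (* [r1 / 3]: the point and the sequence each move by at most this much *)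
  exists (Num.min r (Num.min (r1 / 3) (r2 / 2))) => [|w zw].
    by rewrite !lt_min r0 !divr_gt0.
  have {}zw i : [/\ nrm (z i - w i) <= r, nrm (z i - w i) <= r1 / 3 &
                    nrm (z i - w i) <= r2 / 2].
    by have := zw i; rewrite !le_min => /and3P[].
  have zw12 i : nrm (pt z i - pt w i) <= nrm (z i - w i) /\
      nrm ((z i).2 - (w i).2) <= nrm (z i - w i).
    by rewrite (nrm_prod_banach (z i - w i)) !le_max !lexx orbT.
  rewrite truncateS (splitr e).
  have tr := sc_in_norm (sc_mem_truncate gs k (fun j => inc z j - inc w j)).
  apply: le_trans (sc_inD tr (sc_in_single gsls k (inc z k - inc w k))).2 _.
  apply: lerD; first by apply: rP => i; have [] := zw i.
  rewrite !incj opprD opprK addrACA [X in nrm (_ + X)]addrC (splitr (e / 2)).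
  apply: le_trans (ler_nrmD _ _) _; apply: lerD; apply: ltW; last first.
    rewrite nrmBC; apply: r2P => i; have [_ _ zw2] := zw i.
    by rewrite (le_lt_trans (zw12 i).1)// (le_lt_trans zw2)// gtr_pMr// invf_lt1// ltr1n.
  apply: r1P => i; have [_ zw1 _] := zw i.
  rewrite opprD addrACA.
  have -> : sc_seq gs1 (E i) (z i).2 k - sc_seq gs1 (E i) (w i).2 k =
      sc_seq gs1 (E i) ((z i).2 - (w i).2) k by rewrite linearB.
  apply: le_lt_trans (ler_nrmD _ _) _.
  have sn := nrm_le_sc_norm k (imageT (sc_seq gs1 (E i)) ((z i).2 - (w i).2)).
  rewrite sc_normE in sn.
  have [h1 h2] := zw12 i.
  rewrite (le_lt_trans (lerD h1 (le_trans sn h2)))//.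
  by move: zw1 r10; set t := nrm _ => zw1 r10; lra.
have [|C C0 CP] := multilinear_lsc_bounded Psil.
  move=> z M; rewrite Psin => /(sc_norm_truncate_gt gsfd (incg z))[k Mk].
  have e0 : 0 < (sc_norm gs (truncate k (inc z)) - M) / 2.
    by rewrite divr_gt0 ?subr_gt0.
  have [r r0 rP] := small k z _ e0; exists r => // w zw; rewrite Psin.
  apply: lt_le_trans (sc_norm_truncate_le gsfd k (incg w)).
  have trE : truncate k (inc z) =
      fun j => truncate k (fun j => inc z j - inc w j) j + truncate k (inc w) j.
    apply/funext => j; rewrite /truncate; case: ifP => _; last by rewrite addr0.
    by rewrite subrK.
  have := sc_inD (sc_in_norm (sc_mem_truncate gs k (fun j => inc z j - inc w j)))
    (sc_in_norm (sc_mem_truncate gs k (inc w))).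
  rewrite -trE => -[_ h]; have := rP w zw.
  by move: h Mk; set p := sc_norm _ _; set q := sc_norm _ _; set t := sc_norm _ _; lra.
exists C => // a x xg.
pose s i : sc_space gs1 (E i) := projT1 (cid2 (xg i)).
have sE i : sc_seq gs1 (E i) (s i) = x i by rewrite /s; case: cid2.
have := CP (fun i => (a i, s i)); rewrite Psin /inc.
have -> : sq (fun i => (a i, s i)) = x.
  by apply: functional_extensionality_dep => i; rewrite /sq sE.
move/le_trans; apply; rewrite ler_wpM2l ?(ltW C0)// ler_prod// => i _.
rewrite nrm_ge0 nrm_prod_banach/= -sE sc_normE ge_max.
by rewrite lerDl lerDr !nrm_ge0.
Qed.

End Summing.

(** ** The three summing norms as least constants *)

Section SummingNorms.
Context (R : realType) (kind : scalar_kind).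
Local Notation K := (scalar R kind).
Local Notation Kb := (scalar_banach R kind).
Local Notation Banach := (banach R kind).
Variables gs gs1 : sequence_class R kind.
Hypotheses (gsfd : finitely_determined gs)
  (gsls : linearly_stable gs) (gs1ls : linearly_stable gs1).

Section MultilinearMaps.
Context (n : nat) (E : 'I_n -> Banach) (F : Banach).
Implicit Types (T : (forall i, E i) -> F) (a : forall i, E i).

Lemma ev_multi_normE T : ev_multi_norm gs gs1 T =
  best_const [set ax : (forall i, E i) * (forall i, nat -> E i) |
                forall i, sc_mem gs1 (ax.2 i)]
    (fun ax => sc_norm gs (multi_increments T ax.1 ax.2))
    (fun ax => \prod_i (nrm (ax.1 i) + sc_norm gs1 (ax.2 i))).
Proof.
congr inf; apply/seteqP; split=> C [C0 CT]; split=> //.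
  by move=> [a x]; exact: CT.
by move=> a x xg; exact: (CT (a, x)).
Qed.

Lemma multi_weight_ge0 a (x : forall i, nat -> E i) :
  0 <= \prod_i (nrm (a i) + sc_norm gs1 (x i)).
Proof. by apply: prodr_ge0 => i _; rewrite addr_ge0 ?nrm_ge0 ?sc_norm_ge0. Qed.

Lemma ev_multi_norm_ge0 T : 0 <= ev_multi_norm gs gs1 T.
Proof. by rewrite ev_multi_normE best_const_ge0. Qed.

Lemma ev_multi_in T (a : forall i, E i) (x : forall i, nat -> E i) (A X : 'I_n -> R) :
  ev_multi_mem gs gs1 T ->
  (forall i, nrm (a i) <= A i) -> (forall i, sc_in gs1 (X i) (x i)) ->
  sc_in gs (ev_multi_norm gs gs1 T * \prod_i (A i + X i)) (multi_increments T a x).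
Proof.
move=> Tmem aA xX; have xg i := (xX i).1.
split; first exact: Tmem.2.
have [C C0 CT] := ev_multi_bounded gsfd gsls Tmem.
have := best_constP (D := [set ax : (forall i, E i) * (forall i, nat -> E i) |
                forall i, sc_mem gs1 (ax.2 i)])
    (p := fun ax => sc_norm gs (multi_increments T ax.1 ax.2))
    (w := fun ax => \prod_i (nrm (ax.1 i) + sc_norm gs1 (ax.2 i)))
    (fun ax _ => multi_weight_ge0 ax.1 ax.2).
move=> /(_ _ (a, x) xg)/= h; rewrite -ev_multi_normE in h.
apply: le_trans (h _) _; first by exists C => // -[].
rewrite ler_wpM2l ?ev_multi_norm_ge0// ler_prod// => i _.
by rewrite addr_ge0 ?nrm_ge0 ?sc_norm_ge0//= lerD// (xX i).2.
Qed.

Lemma ev_multi_intro T C :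
  continuous_multilinear T -> 0 <= C ->
  (forall a (x : forall i, nat -> E i), (forall i, sc_mem gs1 (x i)) ->
    sc_in gs (C * \prod_i (nrm (a i) + sc_norm gs1 (x i))) (multi_increments T a x)) ->
  ev_multi_mem gs gs1 T /\ ev_multi_norm gs gs1 T <= C.
Proof.
move=> TP C0 CT; split; first by split=> // a x xg; have [] := CT a x xg.
rewrite ev_multi_normE; apply: best_const_le => // -[a x] //= xg.
  by have [] := CT a x xg.
exact: multi_weight_ge0.
Qed.

End MultilinearMaps.

(** Through these sequences, bounds on increments become bounds on values. *)
Lemma multi_increments_single n (E : 'I_n.+1 -> Banach) (F : Banach)
    (T : (forall i, E i) -> F) (a : forall i, E i) :
  multilinear T ->
  multi_increments T (fun i => 0 : E i) (fun i => single 0 (a i)) 0 = T a.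
Proof.
move=> Tl; rewrite /multi_increments (multilinear_eq0 Tl (a := fun i => 0 : E i) (i := ord0))// subr0.
by congr T; apply: functional_extensionality_dep => i; rewrite add0r.
Qed.

Lemma nrm_le_ev_multi_norm n (E : 'I_n.+1 -> Banach) (F : Banach)
    (T : (forall i, E i) -> F) (a : forall i, E i) :
  ev_multi_mem gs gs1 T -> nrm (T a) <= ev_multi_norm gs gs1 T * \prod_i nrm (a i).
Proof.
move=> Tmem.
have z0 i : nrm (0 : E i) <= 0 by rewrite nrm0.
have := ev_multi_in (A := fun=> 0) Tmem z0 (fun i => sc_in_single gs1ls 0 (a i)).
under eq_bigr do rewrite add0r.
move=> [h1 h2]; apply: le_trans h2.
by rewrite -(multi_increments_single a Tmem.1.1); exact: nrm_le_sc_norm.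
Qed.

Lemma ev_multi_of_linear (E : 'I_1 -> Banach) (F : Banach) (u : E ord0 -> F) :
  summing_mem gs gs1 u -> ev_multi_mem gs gs1 (fun x : forall i, E i => u (x ord0)).
Proof.
move=> [uP umem]; split; first split.
- move=> a i c x y; have ei : i = ord0 := ord1 i; subst i.
  by rewrite !dfwithin uP.1.
- by move=> x; apply: continuous_comp; [exact: continuous_coordinate|exact: uP.2].
- move=> a x xg; have -> : multi_increments (fun x => u (x ord0)) a x = u \o x ord0.
    by apply/funext => j; rewrite /multi_increments (cl_D uP) addrC addKr.
  exact: umem.
Qed.

Section LinearMaps.
Context (E F : Banach).
Implicit Types u : E -> F.

Lemma summing_normE u : summing_norm gs gs1 u =
  best_const (@sc_mem _ _ gs1 E) (fun x => sc_norm gs (u \o x)) (fun x => sc_norm gs1 x).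
Proof. by []. Qed.

Lemma summing_norm_ge0 u : 0 <= summing_norm gs gs1 u.
Proof. by rewrite summing_normE best_const_ge0. Qed.

Lemma summing_bounded u : summing_mem gs gs1 u ->
  exists2 C, 0 < C & forall x, sc_mem gs1 x -> sc_norm gs (u \o x) <= C * sc_norm gs1 x.
Proof.
move=> umem.
have [C C0 CT] := ev_multi_bounded gsfd gsls (ev_multi_of_linear (E := fun=> E) umem).
exists C => // x xg; have := CT (fun=> 0) (fun=> x) (fun=> xg).
rewrite big_ord1 nrm0 add0r; apply: le_trans; rewrite le_eqVlt; apply/orP; left.
apply/eqP; congr sc_norm; apply/funext => j.
by rewrite /multi_increments (cl_0 umem.1) subr0 add0r.
Qed.

Lemma summing_in u C x : summing_mem gs gs1 u -> sc_in gs1 C x ->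
  sc_in gs (summing_norm gs gs1 u * C) (u \o x).
Proof.
move=> umem [xg xC]; split; first exact: umem.2.
apply: le_trans (best_constP (fun x _ => sc_norm_ge0 gs1 x) (summing_bounded umem) xg) _.
by rewrite ler_wpM2l ?summing_norm_ge0.
Qed.

Lemma summing_intro u C : continuous_linear u -> 0 <= C ->
  (forall x, sc_mem gs1 x -> sc_in gs (C * sc_norm gs1 x) (u \o x)) ->
  summing_mem gs gs1 u /\ summing_norm gs gs1 u <= C.
Proof.
move=> uP C0 Cu; split; first by split=> // x xg; have [] := Cu x xg.
rewrite summing_normE; apply: best_const_le => // x xg; first by have [] := Cu x xg.
exact: sc_norm_ge0.
Qed.

Lemma nrm_le_summing_norm u y : summing_mem gs gs1 u ->
  nrm (u y) <= summing_norm gs gs1 u * nrm y.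
Proof.
move=> umem; have [h1 h2] := summing_in umem (sc_in_single gs1ls 0 y).
exact: le_trans (nrm_le_sc_norm 0 h1) h2.
Qed.

End LinearMaps.

(** ** Multilinear maps with all variables equal *)

Lemma ev_poly_normE n (E F : Banach) (P : E -> F) : ev_poly_norm gs gs1 n P =
  best_const [set bx : E * (nat -> E) | sc_mem gs1 bx.2]
    (fun bx => sc_norm gs (poly_increments P bx.1 bx.2))
    (fun bx => (nrm bx.1 + sc_norm gs1 bx.2) ^+ n).
Proof.
congr inf; apply/seteqP; split=> C [C0 CT]; split=> //.
  by move=> [a x]; exact: CT.
by move=> a x xg; exact: (CT (a, x)).
Qed.

Lemma ev_poly_norm_ge0 n (E F : Banach) (P : E -> F) : 0 <= ev_poly_norm gs gs1 n P.
Proof. by rewrite ev_poly_normE best_const_ge0. Qed.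

Lemma poly_weight_ge0 n (E : Banach) (b : E) (x : nat -> E) :
  0 <= (nrm b + sc_norm gs1 x) ^+ n.
Proof. by rewrite exprn_ge0// addr_ge0 ?nrm_ge0 ?sc_norm_ge0. Qed.

Lemma ev_poly_intro n (E F : Banach) (P : E -> F) C :
  continuous_polynomial n P -> 0 <= C ->
  (forall b x, sc_mem gs1 x ->
     sc_in gs (C * (nrm b + sc_norm gs1 x) ^+ n) (poly_increments P b x)) ->
  ev_poly_mem gs gs1 n P /\ ev_poly_norm gs gs1 n P <= C.
Proof.
move=> PP C0 CP; split; first by split=> // a x xg; have [] := CP a x xg.
rewrite ev_poly_normE; apply: best_const_le => // -[a x] //= xg.
  by have [] := CP a x xg.
exact: poly_weight_ge0.
Qed.

Lemma ev_poly_diagonal n (E F : Banach) (T : ('I_n -> E) -> F) :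
  ev_multi_mem gs gs1 (E := fun=> E) T ->
  ev_poly_mem gs gs1 n (fun x => T (fun=> x)) /\
  ev_poly_norm gs gs1 n (fun x => T (fun=> x)) <= ev_multi_norm gs gs1 (E := fun=> E) T.
Proof.
move=> Tmem; apply: ev_poly_intro; first by exists T => //; exact: Tmem.1.
  exact: ev_multi_norm_ge0.
move=> b x xg.
have := ev_multi_in (E := fun=> E) Tmem (fun=> lexx (nrm b)) (fun=> sc_in_norm xg).
by rewrite prodr_const card_ord.
Qed.

Lemma sum_linear_combination n (E : Banach) (c : 'I_n -> K) (a : 'I_n -> E)
    (x : 'I_n -> nat -> E) j :
  \sum_i c i *: (a i + x i j) = \sum_i c i *: a i + \sum_i c i *: x i j.
Proof. by rewrite -big_split/=; apply: eq_bigr => i _; rewrite scalerDr. Qed.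

(** By polarization, the increments of the associated multilinear map are linear
    combinations of increments of the polynomial. *)
Lemma ev_multi_polar n (E F : Banach) (P : E -> F) :
  ev_poly_mem gs gs1 n P -> ev_multi_mem gs gs1 (E := fun _ : 'I_n => E) (polar P).
Proof.
move=> [/polar_spec[TP Ts PT] Pmem]; split=> // a x xg.
set T := polar P in TP Ts PT *.
pose sg (b : {ffun 'I_n -> bool}) : K := \prod_i (-1) ^+ b i.
pose pt (b : {ffun 'I_n -> bool}) : E := \sum_i ((-1) ^+ b i : K) *: a i.
pose sq (b : {ffun 'I_n -> bool}) j : E := \sum_i ((-1) ^+ b i : K) *: x i j.
pose N : K := 2 ^+ n * n`!%:R.
have N0 : N != 0.
  by rewrite mulf_neq0 ?expf_neq0 ?pnatr_eq0// -lt0n fact_gt0.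
have -> : multi_increments (E := fun=> E) T a x =
    fun j => N^-1 *: \sum_(b : {ffun 'I_n -> bool}) sg b *: poly_increments P (pt b) (sq b) j.
  apply/funext => j; rewrite -[LHS](scalerK N0); congr (_ *: _).
  rewrite /multi_increments scalerBr /N.
  rewrite -(polarization (fun i => a i + x i j) TP.1 Ts) -(polarization a TP.1 Ts).
  rewrite -sumrB; apply: eq_bigr => b _.
  by rewrite -scalerBr -!PT sum_linear_combination.
apply: (sc_normZ N^-1 _).1; apply: sc_mem_sum => b.
apply: (sc_normZ (sg b) _).1; apply: Pmem.
by apply: sc_mem_sum => i; exact: (sc_normZ _ (xg i)).1.
Qed.

Lemma ev_poly_in n (E F : Banach) (P : E -> F) (b : E) (x : nat -> E) A X :
  ev_poly_mem gs gs1 n P -> nrm b <= A -> sc_in gs1 X x ->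
  sc_in gs (ev_poly_norm gs gs1 n P * (A + X) ^+ n) (poly_increments P b x).
Proof.
move=> Pmem bA [xg xX]; split; first exact: Pmem.2.
have := best_constP (D := [set bx : E * (nat -> E) | sc_mem gs1 bx.2])
    (p := fun bx => sc_norm gs (poly_increments P bx.1 bx.2))
    (w := fun bx => (nrm bx.1 + sc_norm gs1 bx.2) ^+ n)
    (fun bx _ => poly_weight_ge0 n bx.1 bx.2).
move=> /(_ _ (b, x) xg)/= h; rewrite -ev_poly_normE in h.
apply: le_trans (h _) _.
  have [C C0 CT] := ev_multi_bounded gsfd gsls (ev_multi_polar Pmem).
  have [_ _ PT] := polar_spec Pmem.1.
  exists C => // -[c y] /= yg; have := CT (fun=> c) (fun=> y) (fun=> yg).
  rewrite prodr_const card_ord; apply: le_trans.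
  rewrite le_eqVlt; apply/orP; left; apply/eqP; congr sc_norm; apply/funext => j.
  by rewrite /poly_increments !PT.
rewrite ler_wpM2l ?ev_poly_norm_ge0// lerXn2r ?nnegrE ?addr_ge0 ?nrm_ge0 ?sc_norm_ge0//.
- exact: le_trans (nrm_ge0 b) bA.
- exact: le_trans (sc_norm_ge0 gs1 x) xX.
- exact: lerD.
Qed.

Lemma continuous_polynomial_at0 n (E F : Banach) (P : E -> F) :
  continuous_polynomial n.+1 P -> P 0 = 0.
Proof.
by move=> [T [Tl _] PT]; rewrite PT (multilinear_eq0 (E := fun=> E) Tl (i := ord0)).
Qed.

Lemma poly_increments_single n (E F : Banach) (P : E -> F) (y : E) :
  continuous_polynomial n.+1 P -> poly_increments P 0 (single 0 y) 0 = P y.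
Proof.
by move=> PP; rewrite /poly_increments (continuous_polynomial_at0 PP) subr0 add0r.
Qed.

End SummingNorms.

Section NormedIdeals.
Context (R : realType) (kind : scalar_kind).
Local Notation K := (scalar R kind).
Local Notation Kb := (scalar_banach R kind).
Local Notation Banach := (banach R kind).
Variables gs gs1 : sequence_class R kind.
Hypotheses (gsfd : finitely_determined gs)
  (gsls : linearly_stable gs) (gs1ls : linearly_stable gs1)
  (gsK : K_closed gs) (gsfc : finitely_coincident gs gs1).

(** ** Functionals *)

Lemma finite_dimensional_scalars : finite_dimensional Kb.
Proof.
exists 1%N, (fun=> 1 : Kb) => x; exists (fun=> x).
by rewrite big_ord1 -[RHS]/((x : K) * 1) mulr1.
Qed.

Lemma sc_in_scalars C (x : nat -> Kb) : sc_in gs1 C x -> sc_in gs C x.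
Proof.
move=> [xg xC]; have [h1 h2] := gsfc finite_dimensional_scalars x.
by have xg' := h1.2 xg; split; rewrite ?h2.
Qed.

Lemma sc_in_functional (E : Banach) (phi : E -> Kb) C (x : nat -> E) :
  continuous_linear phi -> sc_in gs1 C x -> sc_in gs (opnorm phi * C) (phi \o x).
Proof. by move=> phiP xC; apply: sc_in_scalars; exact: sc_in_linear. Qed.

(** Every product with functionals below, in particular (CH3), (CH4), (CP3) and
    (CP4), is an instance: the functionals contribute only their norms and the
    weights of their variables, with no factor for their number. *)
Lemma sc_in_functionals (I : Type) (s : seq I) (E : I -> Banach) (F : Banach)
    (phi : forall i, E i -> Kb) (a : forall i, E i) (x : forall i, nat -> E i)
    (v : F) (w : nat -> F) (Q D : R) :
  (forall i, continuous_linear (phi i)) -> (forall i, sc_mem gs1 (x i)) ->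
  nrm v <= Q -> sc_in gs D w ->
  sc_in gs ((\prod_(i <- s) opnorm (phi i)) *
            (\prod_(i <- s) (nrm (a i) + sc_norm gs1 (x i))) * (Q + D))
    (fun j => (\prod_(i <- s) (phi i (a i + x i j) : K)) *: (v + w j) -
              (\prod_(i <- s) (phi i (a i) : K)) *: v).
Proof.
move=> phiP xg vQ wD.
have aA i := nrm_le_opnorm (phiP i) (a i).
have xX i := sc_in_functional (phiP i) (sc_in_norm (xg i)).
have prodE j : \prod_(i <- s) (phi i (a i + x i j) : K) =
    \prod_(i <- s) (phi i (a i) + phi i (x i j) : K).
  by apply: eq_bigr => i _; rewrite (cl_D (phiP i)).
have := sc_in_products gsls gsK s aA xX vQ wD; rewrite /comp/=.
have -> : (fun j => (\prod_(i <- s) (phi i (a i) + phi i (x i j) : K)) *: (v + w j) -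
              (\prod_(i <- s) (phi i (a i) : K)) *: v) =
    (fun j => (\prod_(i <- s) (phi i (a i + x i j) : K)) *: (v + w j) -
              (\prod_(i <- s) (phi i (a i) : K)) *: v).
  by apply/funext => j; rewrite prodE.
apply: sc_in_le.
under eq_bigr do rewrite -mulrDr.
rewrite big_split/= gerDl oppr_le0.
rewrite mulr_ge0 ?(le_trans (nrm_ge0 _) vQ)// prodr_ge0// => i _.
by rewrite mulr_ge0 ?nrm_ge0// opnorm_ge0.
Qed.

(** ** Normed ideals *)

Lemma opnorm_id : opnorm (id : Kb -> Kb) = 1.
Proof.
have iP : continuous_linear (id : Kb -> Kb) by split=> // x; exact: cvg_id.
apply/eqP; rewrite eq_le opnorm_le//=; last by move=> x; rewrite mul1r.
by have := nrm_le_opnorm iP 1; rewrite (nrm1 R kind) mulr1.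
Qed.

Lemma summing_normed_ideal : normed_operator_ideal (summing_operators gs gs1).
Proof.
split.
- move=> E F; split; first by move=> u [].
  apply: (@normed_subspace_best_const _ _ gs E F _ (@continuous_linear R kind E F)
    _ _ (@sc_mem _ _ gs1 E) (fun x u => u \o x) (fun x => sc_norm gs1 x)).
  + by move=> f; split=> -[].
  + by move=> f; exact: summing_normE.
  + by split=> [c x y|x]; [rewrite scaler0 addr0|exact: cst_continuous].
  + move=> f h [fl fc] [hl hc]; split=> [c x y|x].
      by rewrite fl hl scalerDr addrACA.
    exact: (@cvgD _ F _ (nbhs x) _ f h _ _ (fc x) (hc x)).
  + move=> c f [fl fc]; split=> [d x y|x].
      by rewrite fl scalerDr !scalerA (mulrC c).
    exact: (@cvgZl_tmp _ F _ (nbhs x) _ c f _ (fc x)).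
  + by [].
  + by [].
  + by [].
  + by move=> x _; exact: sc_norm_ge0.
  + by move=> f fmem; exact: (summing_bounded gsfd gsls fmem).
  + move=> f fmem f0; apply/funext => y; apply/nrm_eq0/eqP.
    rewrite eq_le nrm_ge0 andbT.
    have sg := (sc_in_single gs1ls 0 y).1.
    exact: le_trans (nrm_le_sc_norm 0 (fmem.2 _ sg)) (f0 _ sg).
- move=> E F phi y phiP; split.
    exact: continuous_linear_comp phiP (continuous_linear_line y).
  move=> x xg; have := sc_in_line gsls y (sc_in_functional phiP (sc_in_norm xg)).
  by case.
- move=> E0 E F F0 w u v wP umem vP; apply: (summing_intro (u := v \o u \o w)).
  + exact: continuous_linear_comp wP (continuous_linear_comp umem.1 vP).
  + by rewrite !mulr_ge0 ?opnorm_ge0 ?summing_norm_ge0.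
  + move=> x xg; rewrite -!mulrA.
    have wx := sc_in_linear gs1ls wP (sc_in_norm xg).
    exact: (sc_in_linear gsls vP (summing_in gsfd gsls umem wx)).
- have [|//||imem ile] := @summing_intro _ _ gs gs1 Kb Kb id 1.
  + by split=> // x; exact: cvg_id.
  + by move=> x xg; rewrite mul1r; apply: sc_in_scalars; exact: sc_in_norm.
  + apply/eqP; rewrite eq_le ile/=.
    by have := nrm_le_summing_norm gsfd gsls gs1ls (1 : Kb) imem; rewrite (nrm1 R kind) mulr1.
Qed.

Lemma ev_poly_normed_ideal k : (0 < k)%N ->
  normed_polynomial_ideal (ev_polynomials gs gs1) k.
Proof.
case: k => // n _.
have powerP (E F : Banach) (phi : E -> Kb) (y : F) : continuous_linear phi ->
    ev_poly_mem gs gs1 n.+1 (fun x => (phi x : K) ^+ n.+1 *: y) /\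
    ev_poly_norm gs gs1 n.+1 (fun x => (phi x : K) ^+ n.+1 *: y) <=
      opnorm phi ^+ n.+1 * nrm y.
  move=> phiP; apply: ev_poly_intro; first exact: continuous_polynomial_power.
    by rewrite mulr_ge0 ?exprn_ge0 ?nrm_ge0// opnorm_ge0.
  move=> b x xg.
  have := sc_in_functionals (index_enum 'I_n.+1) (E := fun=> E) (fun=> b)
    (fun=> phiP) (fun=> xg) (lexx (nrm y)) (sc_in0 gs F).
  rewrite !prodr_const card_ord addr0 mulrAC.
  by under eq_fun do rewrite !prodr_const card_ord addr0.
split.
- move=> E F; split; first by move=> P [].
  apply: (@normed_subspace_best_const _ _ gs E F _ (@continuous_polynomial R kind n.+1 E F)
    _ _ [set bx : E * (nat -> E) | sc_mem gs1 bx.2]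
    (fun bx P => poly_increments P bx.1 bx.2)
    (fun bx => (nrm bx.1 + sc_norm gs1 bx.2) ^+ n.+1)).
  + move=> f; split=> -[fP fg]; split=> //; first by move=> [b x]; exact: fg.
    by move=> b x xg; exact: (fg (b, x)).
  + by move=> f; exact: ev_poly_normE.
  + exact: continuous_polynomial0.
  + exact: continuous_polynomialD.
  + exact: continuous_polynomialZ.
  + by move=> i; apply/funext => j; rewrite /poly_increments subrr.
  + by move=> i f h; apply/funext => j; rewrite /poly_increments opprD addrACA.
  + by move=> i c f; apply/funext => j; rewrite /poly_increments scalerBr.
  + by move=> i _; exact: poly_weight_ge0.
  + move=> f fmem; exists (ev_poly_norm gs gs1 n.+1 f + 1).
      by rewrite ltr_wpDl// ev_poly_norm_ge0.
    move=> [b x] /= xg; have [_ h] := ev_poly_in gsfd gsls fmem (lexx (nrm b)) (sc_in_norm xg).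
    apply: le_trans h _; rewrite ler_wpM2r ?poly_weight_ge0//.
    by rewrite lerDl.
  + move=> f fmem f0; apply/funext => y; apply/nrm_eq0/eqP.
    rewrite eq_le nrm_ge0 andbT -(poly_increments_single y fmem.1).
    have sg := (sc_in_single gs1ls 0 y).1.
    exact: le_trans (nrm_le_sc_norm 0 (fmem.2 _ _ sg)) (f0 (0, _) sg).
- by move=> E F phi y phiP; exact: (powerP _ _ _ y phiP).1.
- move=> E0 E F F0 w p v wP pmem vP; apply: (ev_poly_intro (P := v \o p \o w)).
  + exact: continuous_polynomial_comp wP pmem.1 vP.
  + by rewrite !mulr_ge0 ?exprn_ge0 ?opnorm_ge0 ?ev_poly_norm_ge0.
  + move=> b x xg.
    have wx := sc_in_linear gs1ls wP (sc_in_norm xg).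
    have := sc_in_linear gsls vP (ev_poly_in gsfd gsls pmem (nrm_le_opnorm wP b) wx).
    rewrite -mulrDr exprMn !mulrA; congr sc_in; apply/funext => j.
    by rewrite /poly_increments /= (cl_D wP) (cl_B vP).
- have iP : continuous_linear (id : Kb -> Kb) by split=> // x; exact: cvg_id.
  have [pmem ple] := powerP Kb Kb id (1 : Kb) iP.
  rewrite opnorm_id expr1n mul1r (nrm1 R kind) in ple.
  have pE : (fun x : Kb => (x : K) ^+ n.+1 *: (1 : Kb)) = (fun c : Kb => (c : K) ^+ n.+1 : Kb).
    by apply/funext => c; rewrite -[LHS]/((c : K) ^+ n.+1 * 1) mulr1.
  rewrite pE in pmem ple; apply/eqP; rewrite eq_le ple/=.
  have z0 : nrm (0 : Kb) <= 0 by rewrite nrm0.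
  have := ev_poly_in gsfd gsls pmem z0 (sc_in_single gs1ls 0 (1 : Kb)).
  rewrite (nrm1 R kind) add0r expr1n mulr1 => -[h1 h2].
  apply: le_trans h2; apply: le_trans (nrm_le_sc_norm 0 h1).
  by rewrite (poly_increments_single _ pmem.1) expr1n (nrm1 R kind).
Qed.

Lemma ev_multi_normed_ideal k : (0 < k)%N ->
  normed_multilinear_ideal (ev_multilinear gs gs1) k.
Proof.
case: k => // n _.
have prodP (E : 'I_n.+1 -> Banach) (F : Banach) (phi : forall i, E i -> Kb) (y : F) :
    (forall i, continuous_linear (phi i)) ->
    let T := fun x : forall i, E i => (\prod_i (phi i (x i) : K)) *: y in
    ev_multi_mem gs gs1 T /\
    ev_multi_norm gs gs1 T <= (\prod_i opnorm (phi i)) * nrm y.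
  move=> phiP T; apply: ev_multi_intro.
  - exact: functional_prod_continuous_multilinear.
  - by rewrite mulr_ge0 ?nrm_ge0// prodr_ge0// => i _; exact: opnorm_ge0.
  - move=> a x xg.
    have := sc_in_functionals (index_enum 'I_n.+1) a phiP xg (lexx (nrm y)) (sc_in0 gs F).
    rewrite addr0 mulrAC; congr sc_in; apply/funext => j.
    by rewrite addr0.
split.
- move=> E F; split; first by move=> T [].
  apply: (@normed_subspace_best_const _ _ gs _ F _ (@continuous_multilinear R kind n.+1 E F)
    _ _ [set ax : (forall i, E i) * (forall i, nat -> E i) | forall i, sc_mem gs1 (ax.2 i)]
    (fun ax T => multi_increments T ax.1 ax.2)
    (fun ax => \prod_i (nrm (ax.1 i) + sc_norm gs1 (ax.2 i)))).
  + move=> f; split=> -[fP fg]; split=> //; first by move=> [b x]; exact: fg.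
    by move=> b x xg; exact: (fg (b, x)).
  + by move=> f; exact: ev_multi_normE.
  + exact: continuous_multilinear0.
  + exact: continuous_multilinearD.
  + exact: continuous_multilinearZ.
  + by move=> i; apply/funext => j; rewrite /multi_increments subrr.
  + by move=> i f h; apply/funext => j; rewrite /multi_increments opprD addrACA.
  + by move=> i c f; apply/funext => j; rewrite /multi_increments scalerBr.
  + by move=> i _; exact: multi_weight_ge0.
  + move=> f fmem; have [C C0 Cf] := ev_multi_bounded gsfd gsls fmem.
    by exists C => // -[a x]; exact: Cf.
  + move=> f fmem f0; apply/funext => y; apply/nrm_eq0/eqP.
    rewrite eq_le nrm_ge0 andbT -(multi_increments_single y fmem.1.1).
    have sg i := (sc_in_single gs1ls 0 (y i)).1.
    exact: le_trans (nrm_le_sc_norm 0 (fmem.2 _ _ sg)) (f0 (_, _) sg).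
- by move=> E F phi y phiP; exact: (prodP _ _ _ y phiP).1.
- move=> E0 E F F0 w T v wP Tmem vP vTw; apply: ev_multi_intro.
  + exact: continuous_multilinear_comp wP Tmem.1 vP.
  + rewrite !mulr_ge0 ?opnorm_ge0 ?ev_multi_norm_ge0// prodr_ge0// => i _.
    exact: opnorm_ge0.
  + move=> b x xg.
    have wx i := sc_in_linear gs1ls (wP i) (sc_in_norm (xg i)).
    have wb i := nrm_le_opnorm (wP i) (b i).
    have := sc_in_linear gsls vP (ev_multi_in gsfd gsls Tmem wb wx).
    under eq_bigr do rewrite -mulrDr.
    rewrite big_split/= !mulrA; congr sc_in; apply/funext => j.
    rewrite /multi_increments /vTw /= (cl_B vP); congr (v (T _) - _).
    by apply: functional_extensionality_dep => i; rewrite (cl_D (wP i)).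
- have iP (i : 'I_n.+1) : continuous_linear (id : Kb -> Kb) by split=> // x; exact: cvg_id.
  have [pmem ple] := prodP (fun=> Kb) Kb (fun=> id) (1 : Kb) iP.
  rewrite big1 in ple; last by move=> i _; exact: opnorm_id.
  rewrite mul1r (nrm1 R kind) in ple.
  have pE : (fun x : 'I_n.+1 -> Kb => (\prod_i (x i : K)) *: (1 : Kb)) =
      (fun c : 'I_n.+1 -> Kb => (\prod_i (c i : K)) : Kb).
    by apply/funext => c; rewrite -[LHS]/((\prod_i (c i : K)) * 1) mulr1.
  rewrite pE in pmem ple; apply/eqP; rewrite eq_le ple/=.
  have := nrm_le_ev_multi_norm gsfd gsls gs1ls (fun=> 1 : Kb) pmem.
  rewrite big1// (nrm1 R kind) big1 ?mulr1// => i _; exact: (nrm1 R kind).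
Qed.

End NormedIdeals.

Section CoherenceAndCompatibility.
Context (R : realType) (kind : scalar_kind).
Local Notation K := (scalar R kind).
Local Notation Kb := (scalar_banach R kind).
Local Notation Banach := (banach R kind).
Variables gs gs1 : sequence_class R kind.
Hypotheses (gsfd : finitely_determined gs)
  (gsls : linearly_stable gs) (gs1ls : linearly_stable gs1)
  (gsK : K_closed gs) (gsfc : finitely_coincident gs gs1).
Local Notation U := (summing_operators gs gs1).
Local Notation P := (ev_polynomials gs gs1).
Local Notation M := (ev_multilinear gs gs1).

(** ** Fixing variables *)

Lemma ev_multi_fix_var k (E : 'I_k.+1 -> Banach) (F : Banach)
    (T : (forall i, E i) -> F) (m : 'I_k.+1) (a : E m) :
  ev_multi_mem gs gs1 T ->
  ev_multi_mem gs gs1 (fix_var T a) /\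
  ev_multi_norm gs gs1 (fix_var T a) <= ev_multi_norm gs gs1 T * nrm a.
Proof.
move=> Tmem; apply: ev_multi_intro.
- exact: fix_var_continuous_multilinear Tmem.1.
- by rewrite mulr_ge0 ?nrm_ge0 ?ev_multi_norm_ge0.
- move=> b x xg.
  pose X i j := insert_var (0 : E m) (fun i' => x i' j) i.
  pose w i := sc_norm gs1 (X i).
  have Xm : X m = fun=> 0 by apply/funext => j; rewrite /X insert_var_at.
  have Xl i : X (lift m i) = x i by apply/funext => j; rewrite /X insert_var_lift.
  have Xg i : sc_in gs1 (w i) (X i).
    apply: sc_in_norm; case: (unliftP m i) => [i'|] e; subst i; rewrite ?Xl ?Xm//.
    exact: (sc_in0 gs1 (E m)).1.
  have w0 : w m = 0.
    apply/eqP; rewrite eq_le sc_norm_ge0 andbT /w Xm.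
    exact: (sc_in0 gs1 (E m)).2.
  have := ev_multi_in gsfd gsls Tmem (fun i => lexx (nrm (insert_var a b i))) Xg.
  rewrite (bigD1_ord m)//= insert_var_at w0 addr0 mulrA.
  under eq_bigr do rewrite insert_var_lift /w Xl.
  congr sc_in; apply/funext => j; rewrite /multi_increments /fix_var -insert_varD.
  by rewrite addr0.
Qed.

Lemma ev_multi_free_var n (E : 'I_n -> Banach) (F : Banach)
    (T : (forall i, E i) -> F) (k : 'I_n) (a : forall i, E i) :
  ev_multi_mem gs gs1 T ->
  summing_mem gs gs1 (free_var T a (k := k)) /\
  summing_norm gs gs1 (free_var T a (k := k)) <=
    ev_multi_norm gs gs1 T * \prod_(j | j != k) nrm (a j).
Proof.
move=> Tmem; apply: summing_intro.
- exact: free_var_continuous_linear Tmem.1.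
- by rewrite mulr_ge0 ?ev_multi_norm_ge0// prodr_ge0// => i _; exact: nrm_ge0.
- move=> x xg.
  pose X i j := dfwith (fun i => 0 : E i) k (x j) i.
  pose w i := if i == k then sc_norm gs1 x else 0.
  pose A i := if i == k then 0 else nrm (a i).
  have Xg i : sc_in gs1 (w i) (X i).
    rewrite /w /X; have [->|ik] := eqVneq i k.
      by under eq_fun do rewrite dfwithin; exact: sc_in_norm.
    by under eq_fun do rewrite dfwithout 1?eq_sym//; exact: sc_in0.
  have aA i : nrm (dfwith a k 0 i) <= A i.
    rewrite /A; have [->|ik] := eqVneq i k; first by rewrite dfwithin nrm0.
    by rewrite dfwithout// eq_sym.
  have := ev_multi_in gsfd gsls Tmem aA Xg.
  rewrite (bigD1 k)//= /A /w eqxx add0r.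
  rewrite (eq_bigr (fun i => nrm (a i))) => [|i /negbTE ->]; last by rewrite addr0.
  rewrite mulrCA mulrC; congr sc_in; apply/funext => j.
  rewrite /multi_increments /free_var (multilinear_eq0 Tmem.1.1 (a := dfwith a k 0) (i := k)) ?dfwithin// subr0.
  congr T; apply: functional_extensionality_dep => i; rewrite /X.
  have [<-|ki] := eqVneq k i; first by rewrite !dfwithin add0r.
  by rewrite !dfwithout// addr0.
Qed.

(** ** Degree 1 *)

Lemma ev_degree1 : degree1_components U P M.
Proof.
split=> [E F u|E F T] /=.
- have linP : continuous_polynomial 1 u -> continuous_linear u.
    move=> [T TP uT].
    rewrite (_ : u = free_var T (fun=> 0) (k := ord0)).
      exact: free_var_continuous_linear.
    apply/funext => x; rewrite uT /free_var; congr T; apply/funext => i.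
    by have -> : i = ord0 := ord1 i; rewrite dfwithin.
  have polP : continuous_linear u -> continuous_polynomial 1 u.
    move=> uP; exists (fun x => u (x ord0)) => //; split.
      move=> a i c x y; have -> : i = ord0 := ord1 i.
      by rewrite !dfwithin uP.1.
    move=> x; apply: continuous_comp (uP.2 _).
    exact: (@continuous_coordinate _ (fun=> E) ord0).
  have incE b x : continuous_linear u -> poly_increments u b x = u \o x.
    by move=> uP; apply/funext => j; rewrite /poly_increments (cl_D uP) addrC addKr.
  have op_pol : summing_mem gs gs1 u -> ev_poly_mem gs gs1 1 u /\
      ev_poly_norm gs gs1 1 u <= summing_norm gs gs1 u.
    move=> umem; apply: ev_poly_intro; first exact: polP umem.1.
      exact: summing_norm_ge0.
    move=> b x xg; rewrite (incE b x umem.1) expr1.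
    apply: sc_in_le (summing_in gsfd gsls umem (sc_in_norm xg)).
    by rewrite ler_wpM2l ?summing_norm_ge0// lerDr nrm_ge0.
  have pol_op : ev_poly_mem gs gs1 1 u -> summing_mem gs gs1 u /\
      summing_norm gs gs1 u <= ev_poly_norm gs gs1 1 u.
    move=> pmem; have uP := linP pmem.1.
    apply: summing_intro => //; first exact: ev_poly_norm_ge0.
    move=> x xg; have z0 : nrm (0 : E) <= 0 by rewrite nrm0.
    have := ev_poly_in gsfd gsls pmem z0 (sc_in_norm xg).
    by rewrite incE// add0r expr1.
  split; first by split=> [/pol_op[]|/op_pol[]].
  by move=> umem; have [pmem ple] := op_pol umem; apply/eqP; rewrite eq_le ple (pol_op pmem).2.
- set u := fun x => _.
  have mul_op : ev_multi_mem gs gs1 T -> summing_mem gs gs1 u /\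
      summing_norm gs gs1 u <= ev_multi_norm gs gs1 T.
    move=> Tmem; have := ev_multi_free_var ord0 (fun i => 0 : E i) Tmem.
    by rewrite big_pred0 ?mulr1// => i; rewrite (_ : i = ord0) ?eqxx//; exact: ord1.
  have TE : T = fun x => u (x ord0).
    apply/funext => x; rewrite /u; congr T; apply: functional_extensionality_dep => i.
    by have ei : i = ord0 := ord1 i; subst i; rewrite dfwithin.
  have op_mul : summing_mem gs gs1 u -> ev_multi_mem gs gs1 T /\
      ev_multi_norm gs gs1 T <= summing_norm gs gs1 u.
    move=> umem; rewrite TE.
    have mem := ev_multi_of_linear umem.
    apply: ev_multi_intro => //; [exact: mem.1|exact: summing_norm_ge0|].
    move=> a x xg; rewrite big_ord1.
    rewrite (_ : multi_increments _ _ _ = u \o x ord0); last first.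
      by apply/funext => j; rewrite /multi_increments (cl_D umem.1) addrC addKr.
    apply: sc_in_le (summing_in gsfd gsls umem (sc_in_norm (xg ord0))).
    by rewrite ler_wpM2l ?summing_norm_ge0// lerDr nrm_ge0.
  split; first by split=> [/mul_op[]|/op_mul[]].
  by move=> umem; have [mmem mle] := op_mul umem; apply/eqP; rewrite eq_le mle (mul_op mmem).2.
Qed.

Lemma ev_ideal_sequence : ideal_sequence U P M.
Proof.
split.
- exact: summing_normed_ideal.
- exact: ev_poly_normed_ideal.
- exact: ev_multi_normed_ideal.
- exact: ev_degree1.
Qed.

(** ** Coherence *)

Lemma ev_CH1 k : CH1 M 1 k.
Proof. by move=> E F T j a Tmem; rewrite mul1r; exact: ev_multi_fix_var. Qed.

Lemma ev_CH5 n : CH5 P M n.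
Proof.
move=> E F p pP; split; first exact: ev_multi_polar.
move=> Tmem; have [mem _] := ev_poly_diagonal gsfd gsls Tmem.
have [_ _ pE] := polar_spec pP.
by rewrite (_ : p = fun x => polar p (fun _ : 'I_n => x))//; apply/funext => x.
Qed.

Lemma ev_CH2 k : CH2 P M 1 k.
Proof.
move=> E F p a pmem; have Tmem := ev_multi_polar pmem.
have [Smem Sle] := ev_multi_fix_var (E := fun=> E) (m := ord0) a Tmem.
have := ev_poly_diagonal gsfd gsls Smem.
rewrite (_ : (fun x => _) = poly_fix1 k p a); last first.
  apply/funext => x; rewrite /fix_var /poly_fix1; congr (polar p); apply/funext => i.
  case: (unliftP ord0 i) => [j|] ->; last by rewrite insert_var_at eqxx.
  by rewrite (insert_var_lift (E := fun=> E)) eq_sym (negbTE (neq_lift _ _)).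
move=> [mem le]; split=> //; rewrite mul1r.
apply: le_trans le _; apply: le_trans Sle _; rewrite ler_wpM2r ?nrm_ge0//.
by rewrite le_max lexx.
Qed.

(** The values and the increments of [T] are both bounded by its norm times the
    weight of its variables; adding the two bounds gives the constant 2. *)
Lemma ev_CH3 k : (0 < k)%N -> CH3 M 2 k.
Proof.
case: k => // n _ E F T phi Tmem phiP; apply: ev_multi_intro.
- exact: mul_functional_continuous_multilinear Tmem.1 phiP.
- by rewrite !mulr_ge0 ?opnorm_ge0 ?ev_multi_norm_ge0.
- move=> a x xg.
  pose a' i := a (lift ord_max i); pose x' i := x (lift ord_max i).
  have wD := ev_multi_in gsfd gsls Tmem (fun i => lexx (nrm (a' i)))
    (fun i => sc_in_norm (xg (lift ord_max i))).
  have vQ : nrm (T a') <=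
      ev_multi_norm gs gs1 T * \prod_i (nrm (a' i) + sc_norm gs1 (x' i)).
    apply: le_trans (nrm_le_ev_multi_norm gsfd gsls gs1ls a' Tmem) _.
    rewrite ler_wpM2l ?ev_multi_norm_ge0// ler_prod// => i _.
    by rewrite nrm_ge0 lerDl sc_norm_ge0.
  have := sc_in_functionals gsls gs1ls gsK gsfc [:: tt] (E := fun=> E ord_max)
    (fun=> a ord_max) (fun=> phiP) (fun=> xg ord_max) vQ wD.
  rewrite !big_seq1 [X in _ -> sc_in _ (_ * X) _](bigD1_ord ord_max)//=.
  rewrite (_ : _ * _ * (_ + _) = 2 * opnorm phi * ev_multi_norm gs gs1 T *
    ((nrm (a ord_max) + sc_norm gs1 (x ord_max)) *
     \prod_i (nrm (a' i) + sc_norm gs1 (x' i)))); last by ring.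
  congr sc_in; apply/funext => j; rewrite !big_seq1.
  rewrite /mul_functional /multi_increments; congr (_ *: _ - _).
  by rewrite addrC subrK.
Qed.

Lemma ev_CH4 k : CH4 P k.
Proof.
move=> E F p phi pmem phiP; split.
  exact: continuous_polynomial_mul_functional pmem.1 phiP.
move=> a x xg.
have [h _] := sc_in_functionals gsls gs1ls gsK gsfc [:: tt] (E := fun=> E)
  (fun=> a) (fun=> phiP) (fun=> xg) (lexx (nrm (p a))) (sc_in_norm (pmem.2 a x xg)).
move: h; congr sc_mem; apply/funext => j; rewrite !big_seq1.
rewrite /poly_mul_functional /poly_increments !expr1; congr (_ *: _ - _).
by rewrite addrC subrK.
Qed.

(** ** Compatibility *)

Lemma ev_CP1 n : CP1 U M 1 n.
Proof. by move=> E F T k a Tmem; rewrite mul1r; exact: ev_multi_free_var. Qed.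

Lemma ev_CP2 n : CP2 U P M 1 n.
Proof.
move=> E F p a pmem; have Tmem := ev_multi_polar pmem.
have := ev_multi_free_var (E := fun=> E) ord_max (fun=> a) Tmem.
rewrite (_ : free_var _ _ (k := ord_max) = poly_fix_but1 n p a); last first.
  apply/funext => x; rewrite /free_var /poly_fix_but1; congr (polar p); apply/funext => i.
  by have [->|ik] := eqVneq i ord_max; rewrite ?dfwithin// dfwithout// eq_sym.
rewrite prodr_const (_ : #|_| = n); last by rewrite cardC1 card_ord.
move=> [mem le]; split=> //; rewrite mul1r.
apply: le_trans le _; rewrite ler_wpM2r ?exprn_ge0 ?nrm_ge0//.
by rewrite le_max lexx.
Qed.

(** For a linear [u] the bounds on value and increment add up to the norm of [u]
    times the exact weight of the last variable, whence the constant 1. *)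
Lemma ev_CP3 n : CP3 U M 1 n.
Proof.
move=> E F u phi umem phiP; rewrite mul1r; apply: ev_multi_intro.
- exact: mul_functionals_continuous_multilinear umem.1 phiP.
- rewrite mulr_ge0 ?summing_norm_ge0// prodr_ge0// => i _.
  exact: opnorm_ge0.
- move=> a x xg.
  have := sc_in_functionals gsls gs1ls gsK gsfc (index_enum 'I_n)
    (fun i => a (lift ord_max i)) phiP (fun i => xg (lift ord_max i))
    (nrm_le_summing_norm gsfd gsls gs1ls (a ord_max) umem)
    (summing_in gsfd gsls umem (sc_in_norm (xg ord_max))).
  rewrite [X in _ -> sc_in _ (_ * X) _](bigD1_ord ord_max)//=.
  set p := \prod_i opnorm _; set q := \prod_i (_ + _).
  rewrite (_ : p * q * _ = p * summing_norm gs gs1 u *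
    ((nrm (a ord_max) + sc_norm gs1 (x ord_max)) * q)); last by ring.
  congr sc_in; apply/funext => j.
  by rewrite /mul_functionals /multi_increments (cl_D umem.1).
Qed.

Lemma ev_CP4 n : CP4 U P n.
Proof.
move=> E F u phi umem phiP; split.
  exact: continuous_polynomial_power_linear umem.1 phiP.
move=> a x xg.
have [h _] := sc_in_functionals gsls gs1ls gsK gsfc (index_enum 'I_n) (E := fun=> E)
  (fun=> a) (fun=> phiP) (fun=> xg) (lexx (nrm (u a))) (sc_in_norm (umem.2 x xg)).
move: h; congr sc_mem; apply/funext => j; rewrite !prodr_const card_ord.
by rewrite /poly_mul_functional /poly_increments (cl_D umem.1).
Qed.

End CoherenceAndCompatibility.

Theorem theorem3p12 (R : realType) (kind : scalar_kind)
    (gs gs1 : sequence_class R kind) :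
  finitely_determined gs -> finitely_determined gs1 ->
  linearly_stable gs -> linearly_stable gs1 ->
  K_closed gs -> finitely_coincident gs gs1 ->
  coherent (summing_operators gs gs1) (ev_polynomials gs gs1)
    (ev_multilinear gs gs1) /\
  compatible (summing_operators gs gs1) (ev_polynomials gs gs1)
    (ev_multilinear gs gs1).
Proof.
move=> gsfd _ gsls gs1ls gsK gsfc.
have ideals := ev_ideal_sequence gsfd gsls gs1ls gsK gsfc.
split; split=> //.
  exists 1, 1, 2; split=> // k k0; split.
  - exact: ev_CH1.
  - exact: ev_CH2.
  - exact: ev_CH3.
  - exact: ev_CH4.
  - exact: ev_CH5.
exists 1, 1, 1; split=> // n n0; split.
- exact: ev_CP1.
- exact: ev_CP2.
- exact: ev_CP3.
- exact: ev_CP4.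
- exact: ev_CH5.
Qed.
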